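(* Let $(\Phi,\Phi_0)$ be a morphism of Lie groupoids from $G\rightrightarrows M$ to $G'\rightrightarrows M'$. Let $L$ and $L'$ be discrete Lagrangian functions on $G$ and $G'$, respectively, related by $L=L'\circ\Phi$. Then: (i) for every $(g,h)\in G_2$ and every $v\in A_{\beta(g)}G$, $$D_{\mathrm{DEL}}L(g,h)(v)=D_{\mathrm{DEL}}L'\bigl(\Phi(g),\Phi(h)\bigr)\bigl(A_{\beta(g)}\Phi(v)\bigr);$$ (ii) $(\mathcal P^\tau\Phi,\Phi)^*\Theta^+_{L'}=\Theta^+_L$; (iii) $(\mathcal P^\tau\Phi,\Phi)^*\Theta^-_{L'}=\Theta^-_L$; (iv) $(\mathcal P^\tau\Phi,\Phi)^*\Omega_{L'}=\Omega_L$.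
   Context: A Lie groupoid $G\rightrightarrows M$ has source $\alpha$ and target $\beta$ (surjective submersions $G\to M$), identity section $\epsilon:M\to G$, inversion $i(g)=g^{-1}$, and a product $gh$ defined for $(g,h)\in G_2=\{(g,h):\beta(g)=\alpha(h)\}$, with $\alpha(gh)=\alpha(g)$, $\beta(gh)=\beta(h)$. Translations: $l_g:\alpha^{-1}(\beta(g))\to\alpha^{-1}(\alpha(g))$, $h\mapsto gh$, and $r_g:\beta^{-1}(\alpha(g))\to\beta^{-1}(\beta(g))$, $h\mapsto hg$. Put $V\alpha=\ker T\alpha$, $V\beta=\ker T\beta$. The Lie algebroid $\tau:AG\to M$ of $G$ has fibre $A_xG=V_{\epsilon(x)}\alpha$. For $X\in\Gamma(\tau)$ define vector fields on $G$ by $\overleftarrow X(g)=(T_{\epsilon(\beta(g))}l_g)(X(\beta(g)))$ (a section of $V\alpha$) and $\overrightarrow X(g)=-(T_{\epsilon(\alpha(g))}(r_g\circ i))(X(\alpha(g)))$ (a section of $V\beta$). The bracket and anchor of $AG$ are given by $\overleftarrow{[\![X,Y]\!]}=[\overleftarrow X,\overleftarrow Y]$ and $\rho(X)(x)=(T_{\epsilon(x)}\beta)(X(x))$. The vector bundle $\pi^\tau:\mathcal P^\tau G\equiv V\beta\oplus_G V\alpha\to G$ carries the Lie algebroid structure with anchor $(X_g,Y_g)\mapsto X_g+Y_g$ and bracket characterized by $[\![(\overrightarrow X,\overleftarrow Y),(\overrightarrow{X'},\overleftarrow{Y'})]\!]=(-\overrightarrow{[\![X,X']\!]},\overleftarrow{[\![Y,Y']\!]})$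 for $X,Y,X',Y'\in\Gamma(\tau)$. $d$ is the differential of this Lie algebroid: $dF(Z)=\rho(Z)F$ for functions, $d\mu(Z,W)=\rho(Z)(\mu(W))-\rho(W)(\mu(Z))-\mu([\![Z,W]\!])$ for sections $\mu$ of the dual bundle. The same constructions apply to $G'$. A discrete Lagrangian is a smooth function $L:G\to\mathbb R$. The Poincaré–Cartan 1-sections are $\Theta_L^-(g)(X_g,Y_g)=-X_g(L)$ and $\Theta_L^+(g)(X_g,Y_g)=Y_g(L)$ for $(X_g,Y_g)\in V_g\beta\oplus V_g\alpha$; one has $d\Theta_L^+=d\Theta_L^-$, and the Poincaré–Cartan 2-section is $\Omega_L=-d\Theta_L^+=-d\Theta_L^-$. The discrete Euler–Lagrange operator $D_{\mathrm{DEL}}L:G_2\to A^*G$ ($A^*G$ the dual bundle of $AG$) is, for $v\in A_{\beta(g)}G$, $D_{\mathrm{DEL}}L(g,h)(v)=v\bigl(L\circ l_g+L\circ r_h\circ i\bigr)\in\mathbb{R}$, where the function $L\circ l_g+L\circ r_h\circ i$ is defined on $\alpha^{-1}(\beta(g))$ and $v$ is a tangent vector to it at $\epsilon(\beta(g))$. A Lie groupoid morphism is a smooth map $\Phi:G\to G'$ sending composable pairs to composable pairs with $\Phi(gh)=\Phi(g)\Phi(h)$; it induces a smooth base map $\Phi_0:M\to M'$. $A_x\Phi:A_xG\to A_{\Phi_0(x)}G'$ is the restriction of $T_{\epsilon(x)}\Phi$. The prolongation $\mathcal P^\tau\Phi:V\beta\oplus_GV\alpha\to V\beta'\oplus_{G'}V\alpha'$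 is $\mathcal P^\tau_g\Phi(V,W)=(T_g\Phi(V),T_g\Phi(W))$. For a vector bundle map $\Psi$ over $\Psi_0$, $((\Psi,\Psi_0)^*\phi)(g)(a_1,\dots,a_k)=\phi(\Psi_0(g))(\Psi a_1,\dots,\Psi a_k)$. *)

(* Defs.v *)
(* Smooth manifolds, Lie groupoids and discrete Lagrangian mechanics. *)
From HB Require Import structures.
From mathcomp Require Import all_boot all_order all_algebra.
From mathcomp Require Import all_classical all_reals all_analysis.
Import Order.TTheory GRing.Theory Num.Theory.
Import numFieldNormedType.Exports.

Set Implicit Arguments.
Unset Strict Implicit.
Unset Printing Implicit Defensive.

Local Open Scope classical_set_scope.
Local Open Scope ring_scope.

Section Manifolds.
Variable R : realType.

(* f is of class C^k on the open set U. *)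
Fixpoint Ck (n k : nat) (U : set 'rV[R]_n) (f : 'rV[R]_n -> R) : Prop :=
  (forall x, U x -> {for x, continuous f}) /\
  match k with
  | 0 => True
  | k'.+1 => forall i : 'I_n,
      (forall x, U x -> derivable f x (delta_mx 0 i)) /\
      Ck k' U (fun x => 'D_(delta_mx 0 i) f x)
  end.

Definition Cinfty (n m : nat) (U : set 'rV[R]_n) (f : 'rV[R]_n -> 'rV[R]_m) :=
  forall (i : 'I_m) (k : nat), Ck k U (fun x => f x 0 i).

(* A homeomorphism from an open set cdom onto an open set of R^n. Both
   cfun and its inverse cinv are total; their values outside cdom and
   cfun @` cdom are irrelevant. *)
Record chart (T : topologicalType) (n : nat) := Chart {
  cdom : set T;
  cfun : T -> 'rV[R]_n;
  cinv : 'rV[R]_n -> T;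
  cdom_open : open cdom;
  cimg_open : open (cfun @` cdom);
  cfunK : forall p, cdom p -> cinv (cfun p) = p;
  cfun_continuous : forall p, cdom p -> {for p, continuous cfun};
  cinv_continuous : forall x, (cfun @` cdom) x -> {for x, continuous cinv} }.

(* The atlas is presented as a family of charts with a preferred chart
   chart_at p around each point p. *)
Record manifold := Manifold {
  mdim : nat;
  mcarrier :> topologicalType;
  chart_at : mcarrier -> chart mcarrier mdim;
  mem_chart_at : forall p, cdom (chart_at p) p;
  chart_compat : forall p q,
    Cinfty (cfun (chart_at p) @` (cdom (chart_at p) `&` cdom (chart_at q)))
           (cfun (chart_at q) \o cinv (chart_at p));
  manifold_hausdorff : hausdorff_space mcarrier;
  manifold_second_countable : @second_countable mcarrier }.

Definition coord (M : manifold) (p : M) : M -> 'rV[R]_(mdim M) :=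
  cfun (chart_at p).

Definition coord_inv (M : manifold) (p : M) : 'rV[R]_(mdim M) -> M :=
  cinv (chart_at p).

Definition smooth_fun_at (M : manifold) (f : M -> R) (p : M) : Prop :=
  exists W : set 'rV[R]_(mdim M),
    [/\ open W, W (coord p p) & forall k, Ck k W (f \o coord_inv p)].

Definition smooth_fun (M : manifold) (f : M -> R) : Prop :=
  forall p, smooth_fun_at f p.

Definition smooth_map (M N : manifold) (F : M -> N) : Prop :=
  forall p, {for p, continuous F} /\
    forall i, smooth_fun_at (fun q => coord (F p) (F q) 0 i) p.

(* Smoothness of F on a subset A of M x N, i.e. existence of smooth local
   extensions around every point of A, written in the product charts.  When A
   is an embedded submanifold this is smoothness of the restriction F|A. *)
Definition smooth_map2_on (M N P : manifold) (A : set (M * N))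
    (F : M -> N -> P) : Prop :=
  forall p q, A (p, q) ->
    exists (W : set 'rV[R]_(mdim M + mdim N))
           (E : 'rV[R]_(mdim M + mdim N) -> 'rV[R]_(mdim P)),
      [/\ open W, W (row_mx (coord p p) (coord q q)), Cinfty W E &
          \forall z \near (p, q), A z ->
            cdom (chart_at (F p q)) (F z.1 z.2) /\
            coord (F p q) (F z.1 z.2) = E (row_mx (coord p z.1) (coord q z.2))].

(* A tangent vector at p is represented by its components in chart_at p; it
   must always be read together with its base point. *)
Definition tangent (M : manifold) : Type := 'rV[R]_(mdim M).

(* The directional derivative v(f), for v tangent at p. *)
Definition act (M : manifold) (p : M) (v : tangent M) (f : M -> R) : R :=
  'D_(v : 'rV[R]_(mdim M)) (f \o coord_inv p) (coord p p).

(* T_p F (v), a tangent vector at F p. *)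
Definition Tmap (M N : manifold) (F : M -> N) (p : M) (v : tangent M) :
    tangent N :=
  \row_i act p v (fun q => coord (F p) (F q) 0 i).

(* v(f) for a function f that is only meaningful on a submanifold A through p,
   and v tangent to A at p: apply v to a smooth local extension of f|A.  The
   result does not depend on the extension when v is tangent to A. *)
Definition act_on (M : manifold) (A : set M) (p : M) (v : tangent M)
    (f : M -> R) : R :=
  act p v (xget (cst 0) [set F : M -> R |
    smooth_fun_at F p /\ \forall q \near p, A q -> F q = f q]).

(* T_p (F|A) (v), for F defined on a submanifold A and v tangent to A at p. *)
Definition Tmap_on (M N : manifold) (A : set M) (F : M -> N) (p : M)
    (v : tangent M) : tangent N :=
  \row_i act_on A p v (fun q => coord (F p) (F q) 0 i).

Definition submersion (M N : manifold) (F : M -> N) : Prop :=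
  smooth_map F /\
  forall p (w : tangent N), exists v : tangent M, Tmap F p v = w.

Definition vector_field (M : manifold) := M -> tangent M.

Definition smooth_vector_field (M : manifold) (X : vector_field M) : Prop :=
  forall f : M -> R, smooth_fun f -> smooth_fun (fun p => act p (X p) f).

(* Components of [X, Y] at p in chart_at p: X(Y(x^i)) - Y(X(x^i)). *)
Definition lie_bracket (M : manifold) (X Y : vector_field M) :
    vector_field M :=
  fun p => \row_i
    (act p (X p) (fun q => act q (Y q) (fun r => coord p r 0 i)) -
     act p (Y p) (fun q => act q (X q) (fun r => coord p r 0 i))).

(* Lie algebroid brackets on a vector bundle over M, whose fibres are subspaces
   of E; sec is the set of smooth sections and rho the action of sections on
   functions given by the anchor. *)
Record lie_algebroid_bracket (M : manifold) (E : lmodType R)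
    (sec : set (M -> E)) (rho : (M -> E) -> (M -> R) -> M -> R)
    (br : (M -> E) -> (M -> E) -> M -> E) : Prop := {
  lab_sec : forall Z W, sec Z -> sec W -> sec (br Z W);
  lab_linear : forall (a : R) Z1 Z2 W, sec Z1 -> sec Z2 -> sec W ->
    br (fun x => a *: Z1 x + Z2 x) W = (fun x => a *: br Z1 W x + br Z2 W x);
  lab_anti : forall Z W, sec Z -> sec W -> br Z W = (fun x => - br W Z x);
  lab_jacobi : forall Z1 Z2 Z3, sec Z1 -> sec Z2 -> sec Z3 ->
    forall x, br (br Z1 Z2) Z3 x + br (br Z2 Z3) Z1 x + br (br Z3 Z1) Z2 x = 0;
  lab_leibniz : forall Z W (f : M -> R), sec Z -> sec W -> smooth_fun f ->
    br Z (fun x => f x *: W x) =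
    (fun x => f x *: br Z W x + rho Z f x *: W x) }.

End Manifolds.

Section Groupoids.
Variable R : realType.

(* Composition reads left to right: gmul g h is meaningful when tgt g = src h,
   and its values on other pairs are irrelevant.  Surjectivity of src and tgt
   follows from src_unit and tgt_unit. *)
Record lie_groupoid := LieGroupoid {
  arrows :> manifold R;
  base : manifold R;
  src : arrows -> base;
  tgt : arrows -> base;
  idsec : base -> arrows;
  ginv : arrows -> arrows;
  gmul : arrows -> arrows -> arrows;
  src_unit : forall x, src (idsec x) = x;
  tgt_unit : forall x, tgt (idsec x) = x;
  src_mul : forall g h, tgt g = src h -> src (gmul g h) = src g;
  tgt_mul : forall g h, tgt g = src h -> tgt (gmul g h) = tgt h;
  mul_assoc : forall g h k, tgt g = src h -> tgt h = src k ->
    gmul (gmul g h) k = gmul g (gmul h k);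
  unit_mul : forall g, gmul (idsec (src g)) g = g;
  mul_unit : forall g, gmul g (idsec (tgt g)) = g;
  src_inv : forall g, src (ginv g) = tgt g;
  tgt_inv : forall g, tgt (ginv g) = src g;
  mul_inv : forall g, gmul g (ginv g) = idsec (src g);
  inv_mul : forall g, gmul (ginv g) g = idsec (tgt g);
  src_submersion : submersion src;
  tgt_submersion : submersion tgt;
  unit_smooth : smooth_map idsec;
  inv_smooth : smooth_map ginv;
  mul_smooth : smooth_map2_on [set gh | tgt gh.1 = src gh.2] gmul }.

Definition composable (G : lie_groupoid) (g h : G) : Prop := tgt g = src h.

(* V_g alpha and V_g beta. *)
Definition Valpha (G : lie_groupoid) (g : G) : set (tangent G) :=
  [set v | Tmap (@src G) g v = 0].

Definition Vbeta (G : lie_groupoid) (g : G) : set (tangent G) :=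
  [set v | Tmap (@tgt G) g v = 0].

Definition alpha_fibre (G : lie_groupoid) (x : base G) : set G :=
  [set k | src k = x].

(* The fibre A_x G of the Lie algebroid. *)
Definition AG (G : lie_groupoid) (x : base G) : set (tangent G) :=
  Valpha (idsec x).

(* Smooth sections of AG; a section is a vector field along idsec, and
   smoothness is tested on smooth functions. *)
Definition AG_section (G : lie_groupoid) (X : base G -> tangent G) : Prop :=
  (forall x, AG x (X x)) /\
  forall f : G -> R, smooth_fun f ->
    smooth_fun (fun x => act (idsec x) (X x) f).

Definition left_field (G : lie_groupoid) (X : base G -> tangent G) :
    vector_field G :=
  fun g => Tmap_on (alpha_fibre (tgt g)) (fun k => gmul g k)
    (idsec (tgt g)) (X (tgt g)).

Definition right_field (G : lie_groupoid) (X : base G -> tangent G) :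
    vector_field G :=
  fun g => - (Tmap_on (alpha_fibre (src g)) (fun k => gmul (ginv k) g)
    (idsec (src g)) (X (src g)) : 'rV[R]_(mdim G)).

Definition is_AG_bracket (G : lie_groupoid)
    (br : (base G -> tangent G) -> (base G -> tangent G) ->
          base G -> tangent G) : Prop :=
  forall X Y, AG_section X -> AG_section Y ->
    AG_section (br X Y) /\
    left_field (br X Y) = lie_bracket (left_field X) (left_field Y).

(* The prolongation V beta (+) V alpha over G. *)
Definition PGspace (G : lie_groupoid) : lmodType R :=
  ('rV[R]_(mdim G) * 'rV[R]_(mdim G))%type.

Definition PG (G : lie_groupoid) (g : G) : set (PGspace G) :=
  [set z | Vbeta g z.1 /\ Valpha g z.2].

Definition PG_section (G : lie_groupoid) : set (G -> PGspace G) :=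
  [set Z | [/\ forall g, PG g (Z g),
               smooth_vector_field (fun g => (Z g).1) &
               smooth_vector_field (fun g => (Z g).2)]].

Definition PG_anchor (G : lie_groupoid) (Z : G -> PGspace G) (f : G -> R) :
    G -> R :=
  fun g => act g ((Z g).1 + (Z g).2) f.

Definition invariant_section (G : lie_groupoid) (X Y : base G -> tangent G) :
    G -> PGspace G :=
  fun g => (right_field X g, left_field Y g).

Definition is_PG_bracket (G : lie_groupoid)
    (brA : (base G -> tangent G) -> (base G -> tangent G) ->
           base G -> tangent G)
    (br : (G -> PGspace G) -> (G -> PGspace G) -> G -> PGspace G) : Prop :=
  lie_algebroid_bracket (@PG_section G) (@PG_anchor G) br /\
  forall X Y X' Y',
    AG_section X -> AG_section Y -> AG_section X' -> AG_section Y' ->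
    br (invariant_section X Y) (invariant_section X' Y') =
    (fun g => (- (right_field (brA X X') g : 'rV[R]_(mdim G)),
               left_field (brA Y Y') g)).

(* The differential of a 1-section mu, evaluated on two sections. *)
Definition PG_d (G : lie_groupoid)
    (br : (G -> PGspace G) -> (G -> PGspace G) -> G -> PGspace G)
    (mu : G -> PGspace G -> R) (Z W : G -> PGspace G) : G -> R :=
  fun g => PG_anchor Z (fun h => mu h (W h)) g -
           PG_anchor W (fun h => mu h (Z h)) g - mu g (br Z W g).

Definition Theta_minus (G : lie_groupoid) (L : G -> R) (g : G)
    (z : PGspace G) : R := - act g z.1 L.

Definition Theta_plus (G : lie_groupoid) (L : G -> R) (g : G)
    (z : PGspace G) : R := act g z.2 L.

(* The pointwise 2-section Omega is - d Theta_plus; only its values on the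
   fibres PG g are meaningful. *)
Definition is_Omega (G : lie_groupoid)
    (br : (G -> PGspace G) -> (G -> PGspace G) -> G -> PGspace G)
    (L : G -> R) (Omega : G -> PGspace G -> PGspace G -> R) : Prop :=
  forall Z W, PG_section Z -> PG_section W ->
    forall g, Omega g (Z g) (W g) = - PG_d br (Theta_plus L) Z W g.

Definition DEL (G : lie_groupoid) (L : G -> R) (g h : G) (v : tangent G) : R :=
  act_on (alpha_fibre (tgt g)) (idsec (tgt g)) v
    (fun k => L (gmul g k) + L (gmul (ginv k) h)).

Record lie_groupoid_morphism (G G' : lie_groupoid) := LieGroupoidMorphism {
  mor :> G -> G';
  mor_smooth : smooth_map mor;
  mor_composable : forall g h, composable g h -> composable (mor g) (mor h);
  mor_mul : forall g h, composable g h ->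
    mor (gmul g h) = gmul (mor g) (mor h) }.

(* A_x Phi; it maps into the fibre over Phi_0 x = src (Phi (idsec x)), since
   Phi (idsec x) = idsec (Phi_0 x). *)
Definition A_map (G G' : lie_groupoid) (Phi : lie_groupoid_morphism G G')
    (x : base G) (v : tangent G) : tangent G' :=
  Tmap Phi (idsec x) v.

Definition P_map (G G' : lie_groupoid) (Phi : lie_groupoid_morphism G G')
    (g : G) (z : PGspace G) : PGspace G' :=
  (Tmap Phi g z.1, Tmap Phi g z.2).

(* Pull-backs by (P Phi, Phi). *)
Definition pullback1 (G G' : lie_groupoid) (Phi : lie_groupoid_morphism G G')
    (phi : G' -> PGspace G' -> R) (g : G) (z : PGspace G) : R :=
  phi (Phi g) (P_map Phi g z).

Definition pullback2 (G G' : lie_groupoid) (Phi : lie_groupoid_morphism G G')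
    (phi : G' -> PGspace G' -> PGspace G' -> R) (g : G)
    (z w : PGspace G) : R :=
  phi (Phi g) (P_map Phi g z) (P_map Phi g w).

End Groupoids.

(* Main.v *)
Require Import Defs.
From HB Require Import structures.
From mathcomp Require Import all_boot all_order all_algebra.
From mathcomp Require Import all_classical all_reals all_analysis.
From mathcomp Require Import ring lra.
Import Order.TTheory GRing.Theory Num.Theory.
Import numFieldNormedType.Exports.

(** A morphism [Phi] of Lie groupoids commutes with multiplication and inversion
    and maps alpha-fibres into alpha-fibres. The operator [DEL], the sections
    [Theta] and the section [Omega] are all derivatives of functions built from
    [L] by translations, so for [L = L' o Phi] the chain rule should give all four
    identities.

    For [Theta] this is literally the chain rule [act_Tmap]. For [DEL] one derives
    along an alpha-fibre a function that is defined on that fibre only, through an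
    arbitrary smooth extension. The result is independent of the extension,
    because a function that vanishes on the fibre of a submersion has zero
    derivative along the fibre ([lagrange_multiplier], [act_fibre],
    [act_on_ext]); naturality is then [act_on_mor].

    For [Omega] a direct approach would compare brackets of sections of the two
    algebroids, but a section of the first is in general not related by [Phi] to
    any section of the second. Instead [Omega] is computed pointwise. Every vector of the
    prolongation at [g] is a pair of a right lift of some [xi] and a left lift of
    some [eta] ([Vbeta_surjective], [Valpha_surjective]), and extends to an
    invariant section, on which the bracket is known. In the formula for the
    differential the second derivatives in left-invariant directions cancel
    against the bracket, and there remains ([Omega_lifts])

      [Omega g ((xi, eta), (xi', eta')) = mixed L g xi eta' - mixed L g xi' eta]

    where [mixed L g xi eta] derives [L (k1^-1 g k2)] once in [k1] and once in
    [k2]. No choice of sections is left in this expression, and a mixed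
    derivative in two separate variables is natural ([mixed_mor]), without
    second derivatives of [Phi].

    This needs enough smooth sections: bump functions give vector fields through
    any vector ([smooth_field_through]), from which sections of the Lie algebroid
    are obtained by projecting along the units ([AG_section_through]); their
    invariant fields are smooth by [left_field_smooth]. It also needs the Lie
    bracket, defined by components, to act as a commutator
    ([act_lie_bracket]), which rests on the symmetry of second derivatives
    ([partialC]). *)

Set Implicit Arguments.
Unset Strict Implicit.
Unset Printing Implicit Defensive.

Local Open Scope classical_set_scope.
Local Open Scope ring_scope.

Local Notation coord := Defs.coord.

(** * Strict differentiability and the chain rule on R^n *)

Section Calculus.
Variable R : realType.

Notation partial i f := (fun x => 'D_(delta_mx 0 i) f x).

(** The hypothesis under which a function with partial derivatives is
    differentiable: the partials exist near [x] and are continuous at [x] only. *)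
Definition C1_at (n : nat) (f : 'rV[R]_n -> R) (x : 'rV[R]_n) : Prop :=
  (\forall y \near x, forall i : 'I_n, derivable f y (delta_mx 0 i)) /\
  forall i : 'I_n, {for x, continuous (partial i f)}.

Lemma near_forall n (T : topologicalType) (x : T) (P : 'I_n -> T -> Prop) :
  (forall i : 'I_n, \forall y \near x, P i y) ->
  \forall y \near x, forall i : 'I_n, P i y.
Proof. exact: filter_forall. Qed.

Lemma coord_le_norm n (v : 'rV[R]_n) i : `|v 0 i| <= `|v|.
Proof.
by rewrite [leRHS]/Num.Def.normr/= mx_normrE; exact: (le_bigmax _ _ (0, i)).
Qed.

Lemma norm_le_coord n (v : 'rV[R]_n) (e : R) : 0 <= e ->
  (forall i, `|v 0 i| <= e) -> `|v| <= e.
Proof.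
move=> e0 ve; rewrite [leLHS]/Num.Def.normr/= mx_normrE.
by apply: bigmax_le => // -[i j] _ /=; rewrite ord1.
Qed.

Lemma norm_lt_coord n (v : 'rV[R]_n) (e : R) : 0 < e ->
  (forall i, `|v 0 i| < e) -> `|v| < e.
Proof.
move=> e0 ve; rewrite [ltLHS]/Num.Def.normr/= mx_normrE.
by apply: bigmax_lt => // -[i j] _ /=; rewrite ord1.
Qed.

(** The difference quotients of [f] at [w + t *: v] in the direction [v] are
    those of the restriction of [f] to the line. *)
Lemma derivable_along_line (V : normedModType R) (f : V -> R) (w v : V) (t : R) :
  derivable f (w + t *: v) v ->
  is_derive t 1 (fun s : R => f (w + s *: v)) ('D_v f (w + t *: v)).
Proof.
have E : (fun h : R => h^-1 *: ((f \o shift (w + t *: v)) (h *: v)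
                               - f (w + t *: v))) =
   (fun h => h^-1 *: (((fun s : R => f (w + s *: v)) \o shift t) (h *: 1)
                               - f (w + t *: v))).
  apply/funext => h /=; congr (_ *: (f _ - _)).
  by rewrite [h *: 1]mulr1 scalerDl addrCA.
move=> df; apply: DeriveDef; first by move: df; rewrite /derivable E.
by rewrite /derive E.
Qed.

(** The two conditions on [t] say that it lies between 0 and [s], whatever the
    sign of [s]. *)
Lemma mean_value_line (V : normedModType R) (f : V -> R) (w v : V) (s : R) :
  (forall t, `|t| <= `|s| -> 0 <= t * s -> derivable f (w + t *: v) v) ->
  exists2 t, `|t| <= `|s| /\ 0 <= t * s &
    f (w + s *: v) - f w = s * 'D_v f (w + t *: v).
Proof.
move=> df; pose phi := fun t : R => f (w + t *: v).
have dphi t : `|t| <= `|s| -> 0 <= t * s ->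
    is_derive t 1 phi ('D_v f (w + t *: v)).
  by move=> ts ts0; apply: derivable_along_line; apply: df.
have cont t : `|t| <= `|s| -> 0 <= t * s -> {for t, continuous phi}.
  move=> ts ts0; apply: differentiable_continuous.
  by apply/derivable1_diffP; case: (dphi t ts ts0).
have phi0 : phi 0 = f w by rewrite /phi scale0r addr0.
have [s0|s0] := leP 0 s.
- have P t : t \in `[0, s] -> `|t| <= `|s| /\ 0 <= t * s.
    by rewrite in_itv/= => /andP[t0 ts]; rewrite !ger0_norm// mulr_ge0.
  have [t tin] : exists2 t, t \in `[0, s] &
      phi s - phi 0 = 'D_v f (w + t *: v) * (s - 0).
    apply: MVT_segment => //.
      move=> t tin; have /P[] : t \in `[0, s].
        by apply: subset_itv_oo_cc tin.
      exact: dphi.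
    apply: derivable_within_continuous => t /P[? ?].
    by case: (dphi t).
  by rewrite phi0 subr0 mulrC => H; exists t => //; exact: P.
- have P t : t \in `[s, 0] -> `|t| <= `|s| /\ 0 <= t * s.
    rewrite in_itv/= => /andP[st t0]; have s0' := ltW s0.
    by rewrite (ler0_norm t0) (ler0_norm s0') lerN2 st mulr_le0.
  have [t tin] : exists2 t, t \in `[s, 0] &
      phi 0 - phi s = 'D_v f (w + t *: v) * (0 - s).
    apply: MVT_segment => //; first exact: ltW.
      move=> t tin; have /P[] : t \in `[s, 0].
        by apply: subset_itv_oo_cc tin.
      exact: dphi.
    apply: derivable_within_continuous => t /P[? ?].
    by case: (dphi t).
  rewrite phi0 sub0r mulrN => H; exists t; first exact: P.
  by rewrite mulrC -[RHS]opprK -H opprB.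
Qed.

(** Strict differentiability, i.e. uniformly in both end points. One moves
    from [z] to [y] one coordinate at a time; the sup-norm ball is a box, so
    the intermediate points stay in it, and the mean value theorem turns each
    move into a partial derivative near [x]. The case [z = x] is the usual
    differentiability; the two-point form makes the fixed point argument of
    [lagrange_multiplier] a contraction. *)
Lemma C1_strict n (f : 'rV[R]_n -> R) (x : 'rV[R]_n) : C1_at f x ->
  forall e, 0 < e -> exists2 d, 0 < d & forall y z, ball x d y -> ball x d z ->
    `|f y - f z - \sum_(i < n) (y - z) 0 i * 'D_(delta_mx 0 i) f x| <= e * `|y - z|.
Proof.
case=> dfx cfx e e0.
have e1 : 0 < e / n.+1%:R by rewrite divr_gt0.
have : \forall y \near x, (forall i : 'I_n, derivable f y (delta_mx 0 i)) /\
    forall i : 'I_n, `|'D_(delta_mx 0 i) f x - 'D_(delta_mx 0 i) f y| <= e / n.+1%:R.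
  have cont : \forall y \near x, forall i : 'I_n,
      `|'D_(delta_mx 0 i) f x - 'D_(delta_mx 0 i) f y| <= e / n.+1%:R.
    by apply: near_forall => i; have /cvgrPdist_le/(_ _ e1) := cfx i.
  by apply: filterS2 dfx cont.
move=> /nbhs_ballP[d d0 H]; exists d => // y z yd zd.
pose w k : 'rV[R]_n := \row_i (if (i < k)%N then y 0 i else z 0 i).
have w0 : w 0%N = z by apply/rowP => i; rewrite !mxE.
have wn : w n = y by apply/rowP => i; rewrite !mxE ltn_ord.
have -> : f y - f z = \sum_(i < n) (f (w i.+1) - f (w i)).
  by rewrite -(big_mkord xpredT (fun i => f (w i.+1) - f (w i)))
    telescope_sumr// w0 wn.
rewrite -sumrB.
have step (i : 'I_n) : `|f (w i.+1) - f (w i)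
    - (y - z) 0 i * 'D_(delta_mx 0 i) f x| <= `|y - z| * (e / n.+1%:R).
  have wS : w i.+1 = w i + (y - z) 0 i *: delta_mx 0 i.
    apply/rowP => j; rewrite !mxE eqxx/= ltnS.
    case: (eqVneq j i) => [->|ji]; first by rewrite leqnn ltnn mulr1 addrC subrK.
    by rewrite mulr0 addr0 leq_eqVlt (inj_eq val_inj) (negbTE ji).
  have inball t : `|t| <= `|(y - z) 0 i| -> 0 <= t * (y - z) 0 i ->
      ball x d (w i + t *: delta_mx 0 i).
    move=> t1 t2; split => // a j; rewrite ord1 /ball/= !mxE eqxx/=.
    have [_ /(_ 0 j)] := yd; rewrite /ball/= => yj.
    have [_ /(_ 0 j)] := zd; rewrite /ball/= => zj.
    case: (eqVneq j i) => [ji|ji]; last by rewrite mulr0 addr0; case: ifP.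
    rewrite ji ltnn mulr1.
    move: yj zj t1 t2; rewrite ji !mxE !ltr_norml => /andP[? ?] /andP[? ?].
    have [u|u] := leP 0 (y 0 i - z 0 i).
      rewrite [`|y 0 i - _|]ger0_norm// ler_norml => /andP[? ?] ?.
      have [u'|u'] := eqVneq (y 0 i - z 0 i) 0; first by apply/andP; split; lra.
      have : 0 <= t by rewrite -(pmulr_lge0 (x := y 0 i - z 0 i))// lt_neqAle eq_sym u'.
      by move=> ?; apply/andP; split; lra.
    rewrite (ler0_norm (ltW u)) ler_norml => /andP[? ?].
    rewrite -mulrNN pmulr_lge0 ?oppr_gt0// oppr_ge0 => ?.
    by apply/andP; split; lra.
  have [|t [t1 t2]] := @mean_value_line _ f (w i) (delta_mx 0 i) ((y - z) 0 i).
    by move=> t t1 t2; apply: (H _ (inball t t1 t2)).1.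
  rewrite wS => ->; rewrite -mulrBr normrM ler_pM//; first exact: coord_le_norm.
  by rewrite distrC; apply: (H _ (inball t t1 t2)).2.
apply: (le_trans (ler_norm_sum _ _ _)).
apply: (le_trans (ler_sum _ (fun i _ => step i))).
rewrite sumr_const card_ord -[leLHS]mulr_natl mulrCA [leRHS]mulrC ler_wpM2l// mulrCA.
by rewrite ler_piMr ?(ltW e0)// ler_pdivrMr// mul1r ler_nat.
Qed.

Lemma linear_form_le n (a u : 'I_n -> R) (c : R) :
  (forall i, `|u i| <= c) -> `|\sum_(i < n) u i * a i| <= (\sum_(i < n) `|a i|) * c.
Proof.
move=> uc; rewrite (le_trans (ler_norm_sum _ _ _))// mulr_suml ler_sum// => i _.
by rewrite normrM mulrC ler_wpM2l.
Qed.

Lemma continuousPeps (T : topologicalType) (f : T -> R) (x : T) :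
  {for x, continuous f} <->
  (forall e, 0 < e -> \forall y \near x, `|f x - f y| <= e).
Proof. exact: (@cvgrPdist_le _ _ _ (nbhs x) _ f (f x)). Qed.

(** The inner function is only asked to be derivable in the direction [v]:
    the first order expansion of [f] at [F x] is evaluated along the curve
    [F (x + h v)]. Hence the same lemma serves for functions of several
    variables and for curves. *)
Lemma chain_rule (V : normedModType R) n (f : 'rV[R]_n -> R)
    (F : V -> 'rV[R]_n) (x v : V) : C1_at f (F x) -> derivable F x v ->
  is_derive x v (f \o F)
    (\sum_(i < n) ('D_v F x) 0 i * 'D_(delta_mx 0 i) f (F x)).
Proof.
move=> f1 dF; set D : 'rV[R]_n := 'D_v F x.
pose q h : 'rV[R]_n := h^-1 *: ((F \o shift x) (h *: v) - F x).
pose l (u : 'rV[R]_n) := \sum_(i < n) u 0 i * 'D_(delta_mx 0 i) f (F x).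
have qD : q h @[h --> 0^'] --> D by exact: dF.
have lB u w : l u - l w = l (u - w).
  by rewrite /l -sumrB; apply: eq_bigr => i _; rewrite !mxE mulrBl.
have lZ k u : l (k *: u) = k * l u.
  by rewrite /l mulr_sumr; apply: eq_bigr => i _; rewrite !mxE mulrA.
pose c := \sum_(i < n) `|'D_(delta_mx 0 i) f (F x)|.
have c0 : 0 <= c by rewrite sumr_ge0.
have lc u : `|l u| <= c * `|u|.
  by apply: linear_form_le => i; exact: coord_le_norm.
have lim : h^-1 *: ((f \o F \o shift x) (h *: v) - f (F x)) @[h --> 0^'] --> l D.
  apply/cvgrPdist_le => e e0.
  have D1 : 0 < `|D| + 1 by rewrite ltr_wpDl.
  have c1 : 0 < c + 1 by rewrite ltr_wpDl.
  have e1 : 0 < e / 2 / (`|D| + 1) by rewrite !divr_gt0.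
  have e2 : 0 < e / 2 / (c + 1) by rewrite !divr_gt0.
  have [d d0 H] := C1_strict f1 e1.
  have d1 : 0 < d / (`|D| + 1) by rewrite divr_gt0.
  have N1 : \forall h \near (0 : R)^', `|D - q h| <= 1.
    by apply: (cvgrPdist_le _ _).1 qD _ ltr01.
  have N2 : \forall h \near (0 : R)^', `|D - q h| <= e / 2 / (c + 1).
    by apply: (cvgrPdist_le _ _).1 qD _ e2.
  have N3 : \forall h \near (0 : R)^', h != 0 by exact: nbhs_dnbhs_neq.
  have N4 : \forall h \near (0 : R)^', `|h| < d / (`|D| + 1) by exact: dnbhs0_lt.
  near=> h.
  have h0 : h != 0 by near: h.
  have qn : `|q h| <= `|D| + 1.
    have H1 : `|D - q h| <= 1 by near: h.
    rewrite -[q h](subrK D) (le_trans (ler_normD _ _))// addrC.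
    by rewrite distrC lerD2l.
  have FE : F (h *: v + x) - F x = h *: q h by rewrite /q scalerA divff// scale1r.
  have Fb : ball (F x) d (F (h *: v + x)).
    rewrite -ball_normE/= distrC FE normrZ.
    rewrite (le_lt_trans (ler_wpM2l _ qn))// -ltr_pdivlMr//.
    by near: h.
  have {H} := H _ _ Fb (ballxx _ d0).
  rewrite FE -/(l _) lZ => H.
  have -> : l D - h^-1 *: ((f \o F \o shift x) (h *: v) - f (F x))
     = l (D - q h) - h^-1 * (f (F (h *: v + x)) - f (F x) - h * l (q h)).
    by rewrite -lB mulrBr mulrA mulVf// mul1r opprB addrA subrK.
  rewrite (le_trans (ler_normB _ _))// (splitr e) lerD//.
    rewrite (le_trans (lc _))//.
    have H2 : `|D - q h| <= e / 2 / (c + 1) by near: h.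
    rewrite (le_trans (ler_wpM2l c0 H2))// mulrCA ler_piMr ?divr_ge0 ?(ltW e0)//.
    by rewrite ler_pdivrMr// mul1r lerDl.
  rewrite normrM (le_trans (ler_wpM2l _ H))// normrZ normfV.
  rewrite mulrCA mulKf ?normr_eq0//.
  rewrite (le_trans (ler_wpM2l _ qn)) ?divfK ?gt_eqF// ltW//.
by apply: DeriveDef; [apply/cvg_ex; exists (l D) | exact: cvg_lim lim].
Unshelve. all: by end_near. Qed.

Lemma C1_derive n (f : 'rV[R]_n -> R) (x v : 'rV[R]_n) : C1_at f x ->
  is_derive x v f (\sum_(i < n) v 0 i * 'D_(delta_mx 0 i) f x).
Proof.
move=> f1; have := chain_rule (F := id) f1 (@derivable_id _ _ x v).
by rewrite derive_id.
Qed.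

Lemma C1_continuous n (f : 'rV[R]_n -> R) x : C1_at f x -> {for x, continuous f}.
Proof.
move=> f1; have [d d0 H] := C1_strict f1 ltr01.
pose c := \sum_(i < n) `|'D_(delta_mx 0 i) f x| + 1.
have c0 : 0 < c by rewrite ltr_wpDl// sumr_ge0.
apply/continuousPeps => e e0.
have ec : 0 < Num.min d (e / c) by rewrite lt_min d0 divr_gt0.
apply/nbhs_ballP; exists (Num.min d (e / c)) => // y xy.
have xyd : ball x d y by apply: le_ball xy; rewrite ge_min lexx.
move: xy; rewrite -ball_normE/= lt_min => /andP[_ xye].
have {H} := H _ _ xyd (ballxx _ d0); rewrite mul1r => H.
rewrite distrC; apply: (@le_trans _ _ (c * `|y - x|)); last first.
  by rewrite mulrC -ler_pdivlMr// distrC ltW.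
rewrite /c mulrDl mul1r.
rewrite -[X in `|X| <= _](subrK (\sum_(i < n) (y - x) 0 i * 'D_(delta_mx 0 i) f x)).
rewrite (le_trans (ler_normD _ _))// addrC lerD//.
by apply: linear_form_le => i; exact: coord_le_norm.
Qed.

End Calculus.

(** * Functions of class C^k and smooth germs *)

Section SmoothGerms.
Variable R : realType.

Lemma continuous_row (T : topologicalType) n (F : T -> 'rV[R]_n) (x : T) :
  (forall j, {for x, continuous (fun y => F y 0 j)}) -> {for x, continuous F}.
Proof.
move=> cF; apply: (@cvgrPdist_le _ _ _ (nbhs x) _ F (F x)).2 => e e0.
have N : \forall y \near x, forall j : 'I_n, `|F x 0 j - F y 0 j| <= e.
  by apply: near_forall => j; exact: (continuousPeps _ _).1.
apply: filterS N => y Hy; apply: norm_le_coord => [|j]; first exact: ltW.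
by rewrite !mxE.
Qed.

Lemma Ck_sub n k (U V : set 'rV[R]_n) f : V `<=` U -> Ck k U f -> Ck k V f.
Proof.
elim: k f => [|k IH] f VU /= [cf df].
  by split=> // x Vx; apply: cf; exact: VU.
split=> [x Vx|i]; first by apply: cf; exact: VU.
have [d1 d2] := df i; split; last exact: IH.
by move=> x Vx; apply: d1; exact: VU.
Qed.

Lemma Ck_congr n k (U : set 'rV[R]_n) f g : open U ->
  (forall x, U x -> f x = g x) -> Ck k U f -> Ck k U g.
Proof.
move=> oU; elim: k f g => [|k IH] f g fg /= [cf df].
  split=> // x Ux; have fgx : \forall y \near x, f y = g y.
    by apply: filterS fg _; exact: open_nbhs_nbhs.
  apply/continuousPeps => e e0; rewrite -fg//.
  have := (continuousPeps _ _).1 (cf x Ux) e e0.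
  by apply: filterS2 fgx => y ->.
split=> [x Ux|i].
  have fgx : \forall y \near x, f y = g y.
    by apply: filterS fg _; exact: open_nbhs_nbhs.
  apply/continuousPeps => e e0; rewrite -fg//.
  have := (continuousPeps _ _).1 (cf x Ux) e e0.
  by apply: filterS2 fgx => y ->.
have [d1 d2] := df i.
have near_fg x : U x -> \forall y \near x, f y = g y.
  by move=> Ux; apply: filterS fg _; exact: open_nbhs_nbhs.
split; last by apply: IH d2 => x /near_fg; exact: near_eq_derive.
by move=> x Ux; apply: near_eq_derivable (d1 x Ux); exact: near_fg.
Qed.

Lemma CkS n k (U : set 'rV[R]_n) f : Ck k.+1 U f -> Ck k U f.
Proof.
elim: k f => [|k IH] f /= [cf df]; split=> // i.
by have [d1 d2] := df i; split=> //; exact: IH.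
Qed.

Lemma Ck_C1 n (U : set 'rV[R]_n) f x : open U -> U x -> Ck 1 U f -> C1_at f x.
Proof.
move=> oU Ux [_ df]; have nU : nbhs x U by exact: open_nbhs_nbhs.
split=> [|i]; last by have [_ [+ _]] := df i; exact.
by apply: near_forall => i; apply: filterS nU; exact: (df i).1.
Qed.

Lemma Ck_continuous n k (U : set 'rV[R]_n) f x : Ck k U f -> U x ->
  {for x, continuous f}.
Proof. by case: k => [|k] [cf _] /cf. Qed.

(** Continuity of [f], which is part of [Ck], is automatic as soon as the
    partial derivatives are continuous. All closure properties of [Ck] are
    proved by exhibiting the partial derivatives and using induction. *)
Lemma CkS_intro n k (U : set 'rV[R]_n) f (df : 'I_n -> 'rV[R]_n -> R) :
  open U -> (forall i x, U x -> is_derive x (delta_mx 0 i) f (df i x)) ->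
  (forall i, Ck k U (df i)) -> Ck k.+1 U f.
Proof.
move=> oU fdf cdf.
have E i x : U x -> df i x = 'D_(delta_mx 0 i) f x.
  by move=> /(fdf i)[_ ->].
have pdf i : Ck k U (fun x => 'D_(delta_mx 0 i) f x).
  by apply: Ck_congr (cdf i) => // x Ux; exact: E.
split=> [x Ux|i].
  apply: C1_continuous; split=> [|i]; last exact: Ck_continuous (pdf i) Ux.
  apply: near_forall => i; have nU : nbhs x U by exact: open_nbhs_nbhs.
  by apply: filterS nU => y /(fdf i)[].
by split=> // x /(fdf i)[].
Qed.

Lemma Ck_cst n k (U : set 'rV[R]_n) (c : R) : open U -> Ck k U (cst c).
Proof.
move=> oU; elim: k c => [|k IH] c.
  by split=> // x _; exact: cst_continuous.
by apply: (@CkS_intro _ _ _ _ (fun=> cst 0)) => // i x _; exact: is_derive_cst.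
Qed.

Lemma is_derive_coord n (x v : 'rV[R]_n) i :
  is_derive x v (fun y : 'rV[R]_n => y 0 i) (v 0 i).
Proof.
have H : (fun h : R => h^-1 *: (((fun y : 'rV[R]_n => y 0 i) \o shift x) (h *: v) - x 0 i)) @ 0^' --> v 0 i.
  apply/(@cvgrPdist_le R R^o) => e e0.
  near=> h.
  have h0 : h != 0 by near: h; exact: nbhs_dnbhs_neq.
  rewrite /= !mxE addrK [_ *: _]mulKf// subrr normr0 ltW//.
by apply: DeriveDef; [apply/cvg_ex; exists (v 0 i) | exact: cvg_lim H].
Unshelve. all: by end_near. Qed.

Lemma Ck_coord n k (U : set 'rV[R]_n) i : open U -> Ck k U (fun y => y 0 i).
Proof.
move=> oU; case: k => [|k].
  by split=> // x _; exact: coord_continuous.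
apply: (@CkS_intro _ _ _ _ (fun j => cst ((delta_mx 0 j : 'rV[R]_n) 0 i))) => //.
  by move=> j x _; exact: is_derive_coord.
by move=> j; exact: Ck_cst.
Qed.

Lemma Ck_derive n k (U : set 'rV[R]_n) f i x : Ck k.+1 U f -> U x ->
  is_derive x (delta_mx 0 i) f ('D_(delta_mx 0 i) f x).
Proof. by move=> [_ /(_ i)[df _]] Ux; apply: derivableP; exact: df. Qed.

Lemma CkD n k (U : set 'rV[R]_n) f g : open U ->
  Ck k U f -> Ck k U g -> Ck k U (fun x => f x + g x).
Proof.
move=> oU; elim: k f g => [|k IH] f g cf cg.
  split=> // x Ux.
  by apply: (@continuousD _ R^o _ f g); [exact: cf.1|exact: cg.1].
apply: (@CkS_intro _ _ _ _
  (fun i x => 'D_(delta_mx 0 i) f x + 'D_(delta_mx 0 i) g x)) => //.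
  move=> i x Ux; have Df := Ck_derive i cf Ux; have Dg := Ck_derive i cg Ux.
  exact: is_deriveD.
by move=> i; apply: IH; [exact: (cf.2 i).2|exact: (cg.2 i).2].
Qed.

Lemma CkM n k (U : set 'rV[R]_n) f g : open U ->
  Ck k U f -> Ck k U g -> Ck k U (fun x => f x * g x).
Proof.
move=> oU; elim: k f g => [|k IH] f g cf cg.
  split=> // x Ux.
  by apply: (@continuousM _ _ f g); [exact: cf.1|exact: cg.1].
apply: (@CkS_intro _ _ _ _
  (fun i x => f x * 'D_(delta_mx 0 i) g x + g x * 'D_(delta_mx 0 i) f x)) => //.
  move=> i x Ux; have Df := Ck_derive i cf Ux; have Dg := Ck_derive i cg Ux.
  exact: is_deriveM.
move=> i; apply: CkD => //; apply: IH; try exact: CkS.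
  exact: (cg.2 i).2.
exact: (cf.2 i).2.
Qed.

Lemma Ck_sum n k (U : set 'rV[R]_n) m (f : 'I_m -> 'rV[R]_n -> R) : open U ->
  (forall i, Ck k U (f i)) -> Ck k U (fun x => \sum_(i < m) f i x).
Proof.
move=> oU; elim: m f => [|m IH] f cf.
  by apply: Ck_congr (Ck_cst k 0 oU) => // x _; rewrite big_ord0.
have := CkD oU (IH (fun i => f (widen_ord (leqnSn m) i)) (fun i => cf _))
  (cf ord_max).
by apply: Ck_congr => // x _; rewrite big_ord_recr.
Qed.

Lemma derivable_row n m (F : 'rV[R]_n -> 'rV[R]_m) (x v : 'rV[R]_n) :
  (forall j, derivable (fun y => F y 0 j) x v) -> derivable F x v /\
  forall j, ('D_v F x) 0 j = 'D_v (fun y => F y 0 j) x.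
Proof.
move=> dF.
have dF' : derivable F x v by apply/derivable_mxP => i j; rewrite ord1.
by split=> // j; rewrite derive_mx// mxE.
Qed.

(** The components of [F] are assumed to be one class better than the
    conclusion, which keeps the induction short and costs nothing for smooth
    maps. *)
Lemma Ck_comp n m k (U : set 'rV[R]_n) (V : set 'rV[R]_m)
    (F : 'rV[R]_n -> 'rV[R]_m) f : open U -> open V ->
  (forall x, U x -> V (F x)) ->
  (forall j, Ck k.+1 U (fun x => F x 0 j)) -> Ck k.+1 V f -> Ck k U (f \o F).
Proof.
move=> oU oV UV; elim: k f => [|k IH] f cF cf.
  split=> // x Ux.
  apply: continuous_comp; last by case: cf => + _; apply; exact: UV.
  by apply: continuous_row => j; apply: Ck_continuous (cF j) Ux.
apply: (@CkS_intro _ _ _ _ (fun i x => \sum_(j < m)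
   'D_(delta_mx 0 i) (fun y => F y 0 j) x * 'D_(delta_mx 0 j) f (F x))) => //.
- move=> i x Ux.
  have [dF EF] : derivable F x (delta_mx 0 i) /\ forall j,
     ('D_(delta_mx 0 i) F x) 0 j = 'D_(delta_mx 0 i) (fun y => F y 0 j) x.
    by apply: derivable_row => j; have [_ /(_ i)[dFj _]] := cF j; exact: dFj.
  have f1 : C1_at f (F x).
    apply: (@Ck_C1 _ V) => //; first exact: UV.
    by elim: (k) cf => [|k' IHk] cf; [apply: CkS cf|apply: IHk; apply: CkS cf].
  have := chain_rule f1 dF.
  by under eq_bigr do rewrite EF.
move=> i; apply: Ck_sum => // j; apply: CkM => //.
  by have [_ /(_ i)[_]] := cF j; apply: CkS.
apply: (IH (fun y => 'D_(delta_mx 0 j) f y)).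
  by move=> j'; apply: CkS; exact: cF.
by have [_ /(_ j)[_]] := cf.
Qed.

(** The condition that [smooth_fun_at] imposes in a chart, isolated so that it
    can be studied as a property of germs. *)
Definition smooth_at n (f : 'rV[R]_n -> R) (x : 'rV[R]_n) : Prop :=
  exists W : set 'rV[R]_n, [/\ open W, W x & forall k, Ck k W f].

Lemma smooth_at_nbhs n (f : 'rV[R]_n -> R) x (W : set 'rV[R]_n) :
  nbhs x W -> (forall k, Ck k W f) -> smooth_at f x.
Proof.
rewrite nbhsE => -[U [oU Ux] UW] cf; exists U; split=> // k.
exact: Ck_sub (cf k).
Qed.

Lemma smooth_at_near n (f : 'rV[R]_n -> R) x : smooth_at f x ->
  \forall y \near x, smooth_at f y.
Proof.
move=> [W [oW Wx cf]]; have nW : nbhs x W by exact: open_nbhs_nbhs.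
by apply: filterS nW => y Wy; exists W.
Qed.

Lemma smooth_at_C1 n (f : 'rV[R]_n -> R) x : smooth_at f x -> C1_at f x.
Proof. by move=> [W [oW Wx cf]]; exact: Ck_C1 (cf 1%N). Qed.

Lemma smooth_at_congr n (f g : 'rV[R]_n -> R) x :
  (\forall y \near x, f y = g y) -> smooth_at f x -> smooth_at g x.
Proof.
move=> fg [W [oW Wx cf]].
have : nbhs x (W `&` [set y | f y = g y]).
  by apply: filterI => //; exact: open_nbhs_nbhs.
rewrite nbhsE => -[U [oU Ux] UW]; exists U; split=> // k.
apply: (@Ck_congr _ _ _ f) => //; first by move=> y /UW[].
by apply: Ck_sub (cf k) => y /UW[].
Qed.

Lemma smooth_at_comp n m (f : 'rV[R]_m -> R) (F : 'rV[R]_n -> 'rV[R]_m) x :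
  smooth_at f (F x) -> (forall j, smooth_at (fun y => F y 0 j) x) ->
  smooth_at (f \o F) x.
Proof.
move=> [V [oV VFx cf]] sF.
have cF : {for x, continuous F}.
  by apply: continuous_row => j; exact/C1_continuous/smooth_at_C1.
have /boolp.choice[W HW] : forall j, exists W : set 'rV[R]_n,
    [/\ open W, W x & forall k, Ck k W (fun y => F y 0 j)] by exact: sF.
have nW : \forall y \near x, forall j : 'I_m, W j y.
  by apply: near_forall => j; have [? ? _] := HW j; exact: open_nbhs_nbhs.
have nV : \forall y \near x, V (F y) by apply: cF; exact: open_nbhs_nbhs.
have : nbhs x ([set y | forall j, W j y] `&` F @^-1` V) by exact: filterI nW nV.
rewrite nbhsE => -[U [oU Ux] UW]; exists U; split=> // k.
apply: (@Ck_comp _ _ _ _ V) => //; first by move=> y /UW[].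
by move=> j; have [_ _ /(_ k.+1)] := HW j; apply: Ck_sub => y /UW[/(_ j)].
Qed.

Lemma smooth_at_cst n (c : R) (x : 'rV[R]_n) : smooth_at (cst c) x.
Proof.
by exists setT; split=> //; [exact: openT|move=> k; apply: Ck_cst; exact: openT].
Qed.

Lemma smooth_at_coord n i (x : 'rV[R]_n) : smooth_at (fun y => y 0 i) x.
Proof.
by exists setT; split=> //; [exact: openT|move=> k; apply: Ck_coord; exact: openT].
Qed.

Lemma smooth_atD n (f g : 'rV[R]_n -> R) x : smooth_at f x -> smooth_at g x ->
  smooth_at (fun y => f y + g y) x.
Proof.
move=> [V [oV Vx cf]] [W [oW Wx cg]]; have oVW := openI oV oW.
exists (V `&` W); split=> // k; apply: CkD => //.
  by apply: Ck_sub (cf k) => ? [].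
by apply: Ck_sub (cg k) => ? [].
Qed.

Lemma smooth_atM n (f g : 'rV[R]_n -> R) x : smooth_at f x -> smooth_at g x ->
  smooth_at (fun y => f y * g y) x.
Proof.
move=> [V [oV Vx cf]] [W [oW Wx cg]]; have oVW := openI oV oW.
exists (V `&` W); split=> // k; apply: CkM => //.
  by apply: Ck_sub (cf k) => ? [].
by apply: Ck_sub (cg k) => ? [].
Qed.

Lemma smooth_at_sum n m (f : 'I_m -> 'rV[R]_n -> R) x :
  (forall i, smooth_at (f i) x) -> smooth_at (fun y => \sum_(i < m) f i y) x.
Proof.
elim: m f => [|m IH] f sf.
  by apply: smooth_at_congr (smooth_at_cst 0 x); near=> y; rewrite big_ord0.
have := smooth_atD (IH (fun i => f (widen_ord (leqnSn m) i)) (fun i => sf _))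
  (sf ord_max).
by apply: smooth_at_congr; near=> y; rewrite big_ord_recr.
Unshelve. all: by end_near. Qed.

Lemma smooth_at_partial n (f : 'rV[R]_n -> R) i x : smooth_at f x ->
  smooth_at (fun y => 'D_(delta_mx 0 i) f y) x.
Proof.
move=> [V [oV Vx cf]]; exists V; split=> // k.
by have [_ /(_ i)[_]] := cf k.+1.
Qed.

Lemma smooth_at_derive n (f : 'rV[R]_n -> R) (v x : 'rV[R]_n) : smooth_at f x ->
  smooth_at (fun y => 'D_v f y) x.
Proof.
move=> sf; apply: (@smooth_at_congr _
  (fun y => \sum_(i < n) v 0 i * 'D_(delta_mx 0 i) f y)).
  near=> y; have : C1_at f y.
    by apply: smooth_at_C1; near: y; exact: smooth_at_near.
  by move=> /(@C1_derive _ _ _ _ v)[_ ->].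
apply: smooth_at_sum => i; apply: smooth_atM; first exact: smooth_at_cst.
exact: smooth_at_partial.
Unshelve. all: by end_near. Qed.

End SmoothGerms.

(** * Symmetry of second derivatives *)

Section Schwarz.
Variable R : realType.

Lemma is_derive_translate (V : normedModType R) (f : V -> R) (x w v : V) (l : R) :
  is_derive (x + w) v f l -> is_derive x v (fun y => f (y + w)) l.
Proof.
have E : (fun h : R => h^-1 *: ((f \o shift (x + w)) (h *: v) - f (x + w))) =
   (fun h => h^-1 *: (((fun y => f (y + w)) \o shift x) (h *: v) - f (x + w))).
  by apply/funext => h /=; rewrite addrA.
by move=> [d1 d2]; apply: DeriveDef; [rewrite /derivable -E|rewrite /derive -E].
Qed.

Lemma dnbhs_limit_unique (u : R -> R) (a b : R) :
  (forall e, 0 < e -> \forall s \near (0 : R)^', `|u s - a| <= e) ->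
  (forall e, 0 < e -> \forall s \near (0 : R)^', `|u s - b| <= e) -> a = b.
Proof.
move=> ua ub; apply/eqP; rewrite -subr_eq0 -normr_le0.
apply/ler_addgt0Pl => e e0; rewrite addr0.
have e2 : 0 < e / 2 by rewrite divr_gt0.
near (0 : R)^' => s.
have H1 : `|u s - a| <= e / 2 by near: s; exact: ua.
have H2 : `|u s - b| <= e / 2 by near: s; exact: ub.
rewrite -[X in `|X|](subrKA (u s)) (le_trans (ler_normD _ _))//.
by rewrite (splitr e) lerD// distrC.
Unshelve. all: by end_near. Qed.

(** Both mixed derivatives are limits, as [s] tends to 0, of the second
    difference of [f] divided by [s ^ 2]. The second difference is symmetric in
    the two directions; the mean value theorem in one of them, followed by
    strict differentiability of the partial derivative in the other, evaluates
    its limit. *)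
Lemma partialC n (f : 'rV[R]_n -> R) i j x : smooth_at f x ->
  'D_(delta_mx 0 i) (fun y => 'D_(delta_mx 0 j) f y) x =
  'D_(delta_mx 0 j) (fun y => 'D_(delta_mx 0 i) f y) x.
Proof.
move=> sf; pose e_ k : 'rV[R]_n := delta_mx 0 k.
have e1 k : `|e_ k| <= 1.
  apply: norm_le_coord => // l; rewrite mxE eqxx/=.
  by case: eqP; rewrite ?normr1 ?normr0.
pose Delta (s : R) a b :=
  (f (x + s *: e_ a + s *: e_ b) - f (x + s *: e_ a)) - (f (x + s *: e_ b) - f x).
have key a b (e : R) : 0 < e -> \forall s \near (0 : R)^',
    `|s^-1 * (s^-1 * Delta s a b)
      - 'D_(e_ b) (fun y => 'D_(e_ a) f y) x| <= e.
  move=> e0; have /smooth_at_C1/C1_strict/(_ _ e0)[d d0 H] :=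
    smooth_at_partial a sf.
  have [W [oW Wx cf]] := sf.
  have /nbhs_ballP[r /= r0 rW] : nbhs x W by exact: open_nbhs_nbhs.
  have m0 : 0 < Num.min d r / 2 by rewrite divr_gt0// lt_min d0.
  have N4 : \forall h \near (0 : R)^', `|h| < Num.min d r / 2 by exact: dnbhs0_lt.
  near=> s.
  have s0 : s != 0 by near: s; exact: nbhs_dnbhs_neq.
  have sm : `|s| < Num.min d r / 2 by near: s.
  have inb t u : `|t| <= `|s| -> `|u| <= `|s| ->
      `|t *: e_ a + u *: e_ b| < Num.min d r.
    move=> ts us; rewrite (le_lt_trans (ler_normD _ _))// !normrZ.
    rewrite (splitr (Num.min d r)) ltrD//.
      by rewrite (le_lt_trans _ sm)// (le_trans _ ts)// ler_piMr.
    by rewrite (le_lt_trans _ sm)// (le_trans _ us)// ler_piMr.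
  have inball t u : `|t| <= `|s| -> `|u| <= `|s| ->
      ball x d (x + t *: e_ a + u *: e_ b) /\ W (x + t *: e_ a + u *: e_ b).
    move=> ts us; have := inb t u ts us; rewrite lt_min => /andP[td tr].
    split; last apply: rW; rewrite -ball_normE/= -addrA opprD addNKr normrN//.
  have n0 : `|0 : R| <= `|s| by rewrite normr0.
  pose phi (y : 'rV[R]_n) := f (y + s *: e_ b) - f y.
  have dphi t : `|t| <= `|s| -> is_derive (x + t *: e_ a) (e_ a) phi
     ('D_(e_ a) f (x + t *: e_ a + s *: e_ b) - 'D_(e_ a) f (x + t *: e_ a)).
    move=> ts; have [_ W1] := inball t s ts (lexx _).
    have [_] := inball t 0 ts n0; rewrite scale0r addr0 => W2.
    have D2 := Ck_derive a (cf 1%N) W2.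
    suff D1 : is_derive (x + t *: e_ a) (e_ a) (fun y => f (y + s *: e_ b))
        ('D_(e_ a) f (x + t *: e_ a + s *: e_ b)) by exact: is_deriveB.
    by apply: is_derive_translate; exact: Ck_derive (cf 1%N) W1.
  have [t ts _|t [ts _]] := @mean_value_line _ _ phi x (e_ a) s.
    by have [] := dphi t ts.
  have [_ ->] := dphi t ts.
  rewrite /phi -/(Delta s a b) => ->.
  rewrite mulKf//.
  have [B1 _] := inball t s ts (lexx _).
  have [] := inball t 0 ts n0; rewrite scale0r addr0 => B2 _.
  have Ed : (x + t *: e_ a + s *: e_ b) - (x + t *: e_ a) = s *: e_ b.
    by rewrite addrC addKr.
  have := H _ _ B1 B2; rewrite Ed (bigD1 b)//= !mxE !eqxx/= mulr1 big1 ?addr0; last first.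
    by move=> k kb; rewrite !mxE eqxx/= (negbTE kb) mulr0 mul0r.
  rewrite normrZ => HH.
  rewrite -(ler_pM2l (x := `|s|)) ?normr_gt0// -normrM mulrBr mulVKf//.
  apply: (le_trans HH); rewrite mulrCA ler_wpM2l//.
  by apply: ler_piMr; [exact: ltW | exact: e1].
have DeltaC s : Delta s i j = Delta s j i.
  have arith (A B D E : R) : A - B - (D - E) = A - D - (B - E) by ring.
  by rewrite /Delta arith [x + _ + _]addrAC.
apply: (@dnbhs_limit_unique (fun s => s^-1 * (s^-1 * Delta s j i))).
  by move=> e e0; exact: key.
by move=> e e0; under eq_near do rewrite -DeltaC; exact: key.
Unshelve. all: by end_near. Qed.

End Schwarz.

(** * Derivatives along the fibres of a submersion, in coordinates *)

Section Lagrange.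
Variable R : realType.

(** The ball is written as a sublevel set of the norm, since the radius is
    allowed to be 0. *)
Lemma contraction_fixpoint m (T : 'rV[R]_m -> 'rV[R]_m) (r : R) :
  (forall u w, `|u| <= r -> `|w| <= r -> `|T u - T w| <= 2^-1 * `|u - w|) ->
  `|T 0| <= r / 2 -> exists2 u, `|u| <= r & T u = u.
Proof.
move=> lT T0; have r0 : 0 <= r.
  have := le_trans (normr_ge0 _) T0.
  by rewrite pmulr_lge0.
pose U : set 'rV[R]_m := [set u | `|u| <= r].
have TU : set_fun U U T.
  move=> u /= ur; rewrite /U/= -[T u](subrK (T 0)) (splitr r).
  rewrite (le_trans (ler_normD _ _))// lerD//.
  have n0 : `|0 : 'rV[R]_m| <= r by rewrite normr0.
  by rewrite (le_trans (lT _ _ ur n0))// subr0 mulrC ler_wpM2r// invr_ge0.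
pose mT := isFun.Build _ _ U U T TU.
pose fT : {fun U >-> U} := HB.pack T mT.
have cl : closed U.
  apply: (@preimage_closed _ _ (fun u : 'rV[R]_m => `|u|) [set y | y <= r]).
    by move=> u _; exact: norm_continuous.
  exact: closed_le.
pose X : completeNormedModType R := HB.pack 'rV[R]_m (Complete.on 'rV[R]_m).
have [||u Uu uT] := @banach_fixed_point R X U fT _ cl.
- exists 2^-1%:nng; split=> /=; first by rewrite invf_lt1 ?ltr1n.
  by move=> [u w] [/= ur wr]; exact: lT.
- by exists 0; rewrite /U/= normr0.
by exists u.
Qed.

(** A function that is constant on the fibre of [s] through [x] has zero
    derivative in the kernel of the derivative of [s]. Let [S] be a linear right
    inverse of that derivative. For small [t], Banach's theorem gives a
    correction [u] with [|u| <= r] such that [x + t v + S u] lies on the fibre: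
    the map [T] below is a contraction by strict differentiability, and
    [T 0] is of order [ep * t], whence [r] is a small multiple of [t]. As [f]
    does not change between [x] and [x + t v + S u], its derivative on [v] is at
    most of order [ep], for every [ep]. This is the part of the implicit
    function theorem that makes derivatives along fibres well defined. *)
Lemma lagrange_multiplier n m (s : 'rV[R]_n -> 'rV[R]_m) (f : 'rV[R]_n -> R)
    (x v : 'rV[R]_n) :
  (forall j, C1_at (fun y => s y 0 j) x) ->
  (forall w : 'rV[R]_m, exists u : 'rV[R]_n,
     forall j, 'D_u (fun y => s y 0 j) x = w 0 j) ->
  (forall j, 'D_v (fun y => s y 0 j) x = 0) ->
  C1_at f x -> (\forall y \near x, s y = s x -> f y = f x) -> 'D_v f x = 0.
Proof.
move=> s1 surj sv f1 fs.
pose ds j (w : 'rV[R]_n) :=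
  \sum_(i < n) w 0 i * 'D_(delta_mx 0 i) (fun y => s y 0 j) x.
have dsE j w : 'D_w (fun y => s y 0 j) x = ds j w.
  by have [_ ->] := C1_derive w (s1 j).
pose df (w : 'rV[R]_n) := \sum_(i < n) w 0 i * 'D_(delta_mx 0 i) f x.
have -> : 'D_v f x = df v by have [_ ->] := C1_derive v f1.
have dsD j u w : ds j (u + w) = ds j u + ds j w.
  by rewrite /ds -big_split; apply: eq_bigr => i _; rewrite mxE mulrDl.
have dsZ j k u : ds j (k *: u) = k * ds j u.
  by rewrite /ds mulr_sumr; apply: eq_bigr => i _; rewrite mxE mulrA.
have dfD u w : df (u + w) = df u + df w.
  by rewrite /df -big_split; apply: eq_bigr => i _; rewrite mxE mulrDl.
have dfZ k u : df (k *: u) = k * df u.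
  by rewrite /df mulr_sumr; apply: eq_bigr => i _; rewrite mxE mulrA.
have /boolp.choice[S_ HS] : forall k : 'I_m, exists u : 'rV[R]_n, forall j,
    ds j u = (delta_mx 0 k : 'rV[R]_m) 0 j.
  by move=> k; have [u Hu] := surj (delta_mx 0 k); exists u => j; rewrite -dsE.
pose S (u : 'rV[R]_m) := \sum_(k < m) u 0 k *: S_ k.
have dsS j u : ds j (S u) = u 0 j.
  have -> : ds j (S u) = \sum_(k < m) u 0 k * ds j (S_ k).
    rewrite /S; elim/big_ind2 : _ => [||k _].
    - by rewrite /ds big1// => i _; rewrite mxE mul0r.
    - by move=> a b a' b' <- <-; rewrite dsD.
    - by rewrite dsZ.
  rewrite (bigD1 j)//= HS mxE !eqxx/= mulr1 big1 ?addr0// => k kj.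
  by rewrite HS mxE eqxx/= eq_sym (negbTE kj) mulr0.
have SB u w : S u - S w = S (u - w).
  by rewrite /S -sumrB; apply: eq_bigr => k _; rewrite !mxE scalerBl.
pose K := \sum_(k < m) `|S_ k| + 1.
have K0 : 0 < K by rewrite ltr_wpDl// sumr_ge0.
have SK u : `|S u| <= K * `|u|.
  rewrite /S (le_trans (ler_norm_sum _ _ _))// /K mulrDl mulr_suml.
  rewrite -[leLHS]addr0 lerD ?mul1r// ler_sum// => k _.
  by rewrite normrZ mulrC ler_wpM2l// coord_le_norm.
pose c := \sum_(i < n) `|'D_(delta_mx 0 i) f x| + 1.
have c0 : 0 < c by rewrite ltr_wpDl// sumr_ge0.
have dfc w : `|df w| <= c * `|w|.
  rewrite /c mulrDl (le_trans (@linear_form_le _ _ _ (fun i => w 0 i) _ (coord_le_norm w)))//.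
  by rewrite lerDl mul1r.
apply/eqP; rewrite -normr_le0; apply/ler_addgt0Pl => e e0; rewrite addr0.
have V0 : 0 < `|v| + 1 by rewrite ltr_wpDl.
(* The first bound makes T a contraction of ratio 1/2, the second one makes
   the contribution of the correction to df smaller than e / 2. *)
pose ep := Num.min (2 * K)^-1 (e / (4 * (c * K * (`|v| + 1)))).
have ep0 : 0 < ep by rewrite lt_min invr_gt0 mulr_gt0//= divr_gt0// !mulr_gt0.
have epK : ep * K <= 2^-1.
  by rewrite -ler_pdivlMr// -invfM ge_min lexx.
have epc : ep * (c * K * (`|v| + 1)) <= e / 4.
  have : ep <= e / (4 * (c * K * (`|v| + 1))) by rewrite ge_min lexx orbT.
  rewrite ler_pdivlMr ?mulr_gt0// => H.
  have -> : ep * (c * K * (`|v| + 1)) = ep * (4 * (c * K * (`|v| + 1))) / 4.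
    by field.
  by rewrite ler_wpM2r.
pose ep' := e / (4 * (`|v| + 1)).
have ep'0 : 0 < ep' by rewrite divr_gt0// mulr_gt0.
have Ns : \forall z \near (x, x), forall j : 'I_m,
    `|s z.1 0 j - s z.2 0 j - ds j (z.1 - z.2)| <= ep * `|z.1 - z.2|.
  apply: near_forall => j; have [d d0 H] := C1_strict (s1 j) ep0.
  by apply/nbhs_ballP; exists d => // -[y z] [/= xy xz]; exact: H.
have [d1 /= d10 H1] := (nbhs_ballP _ _).1 Ns.
have [d2 d20 H2] := C1_strict f1 ep'0.
have [d3 /= d30 H3] := (nbhs_ballP _ _).1 fs.
pose d := Num.min d1 (Num.min d2 d3).
have d0 : 0 < d by rewrite !lt_min d10 d20.
(* A single nonzero t suffices, as the final estimate is divided by t. *)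
pose t := d / (4 * (`|v| + 1)).
have t0 : 0 < t by rewrite divr_gt0// mulr_gt0.
pose r := 2 * (ep * (t * `|v|)).
have tv : `|t *: v| = t * `|v| by rewrite normrZ gtr0_norm.
have tvd : 2 * (t * `|v|) < d.
  have E : d = 4 * (t * `|v|) + 4 * t.
    have -> : 4 * (t * `|v|) + 4 * t = t * (4 * (`|v| + 1)) by ring.
    by rewrite /t divfK// gt_eqF// mulr_gt0.
  have tv0 : 0 <= t * `|v| by rewrite mulr_ge0// ltW.
  by rewrite E; lra.
have inb (u : 'rV[R]_m) : `|u| <= r -> `|t *: v + S u| <= 2 * (t * `|v|).
  move=> ur; rewrite (le_trans (ler_normD _ _))// tv mulr_natl mulr2n lerD2l.
  rewrite (le_trans (SK u))// (le_trans (ler_wpM2l (ltW K0) ur))// /r.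
  have tv0 : 0 <= t * `|v| by rewrite mulr_ge0// ltW.
  have -> : K * (2 * (ep * (t * `|v|))) = (2 * (ep * K)) * (t * `|v|) by ring.
  by rewrite ler_piMl// -ler_pdivlMl// mulr1.
have inball u : `|u| <= r -> ball x d (x + (t *: v + S u)).
  move=> ur; rewrite -ball_normE/= opprD addNKr normrN.
  exact: le_lt_trans (inb u ur) tvd.
have r0 : 0 <= r by rewrite !mulr_ge0// ltW.
have S0 : S 0 = 0 by rewrite /S big1// => k _; rewrite mxE scale0r.
have n0 : `|0 : 'rV[R]_m| <= r by rewrite normr0.
pose T (u : 'rV[R]_m) := u - (s (x + (t *: v + S u)) - s x).
have [| |u ur Tu] := @contraction_fixpoint m T r.
- move=> u w ur wr; apply: norm_le_coord => [|j]; first by rewrite mulr_ge0// invr_ge0.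
  have D : (x + (t *: v + S u)) - (x + (t *: v + S w)) = S (u - w).
    by rewrite -SB !addrA opprD addrACA subrr add0r.
  have B1 : ball (x, x) d1 (x + (t *: v + S u), x + (t *: v + S w)).
    by split=> /=; apply: le_ball (inball _ _) => //; rewrite ge_min lexx.
  have := H1 _ B1 j; rewrite /= D dsS => HH.
  rewrite /T !mxE.
  have -> : u 0 j - (s (x + (t *: v + S u)) 0 j - s x 0 j) -
     (w 0 j - (s (x + (t *: v + S w)) 0 j - s x 0 j)) =
     - (s (x + (t *: v + S u)) 0 j - s (x + (t *: v + S w)) 0 j - (u - w) 0 j).
    by rewrite !mxE; ring.
  rewrite normrN (le_trans HH)// (le_trans (ler_wpM2l (ltW ep0) (SK _)))//.
  by rewrite mulrA ler_wpM2r.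
- apply: norm_le_coord => [|j]; first by rewrite divr_ge0.
  have B1 : ball (x, x) d1 (x + (t *: v + S 0), x).
    split=> /=; last exact: ballxx.
    by apply: le_ball (inball _ _) => //; rewrite ge_min lexx.
  have := H1 _ B1 j; rewrite /= [_ - x]addrC addKr dsD dsS !mxE addr0 dsZ.
  rewrite -dsE sv mulr0 subr0 S0 addr0 tv => HH.
  by rewrite sub0r normrN (le_trans HH)// /r [leRHS]mulrC mulKf.
have sx : s (x + (t *: v + S u)) = s x.
  apply/eqP; rewrite -subr_eq0; apply/eqP.
  by rewrite -(subKr u (s (x + (t *: v + S u)) - s x)) -/(T u) Tu subrr.
have fx : f (x + (t *: v + S u)) = f x.
  apply: H3 => //; apply: le_ball (inball _ ur).
  by rewrite ge_min; apply/orP; right; rewrite ge_min lexx orbT.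
have B2 : ball x d2 (x + (t *: v + S u)).
  apply: le_ball (inball _ ur).
  by rewrite ge_min; apply/orP; right; rewrite ge_min lexx.
have := H2 _ _ B2 (ballxx _ d20).
rewrite fx subrr sub0r normrN [_ - x]addrC addKr -/(df _) dfD dfZ => HH.
have A1 : `|df (S u)| <= c * (K * r).
  by rewrite (le_trans (dfc _))// ler_wpM2l ?(ltW c0)// (le_trans (SK u))// ler_wpM2l ?(ltW K0).
have A2 : `|t * df v| <= ep' * (2 * (t * `|v|)) + c * (K * r).
  rewrite -[t * df v](addrK (df (S u))) (le_trans (ler_normB _ _))// lerD//.
  by rewrite (le_trans HH)// ler_wpM2l ?inb// ltW.
move: A2; rewrite normrM gtr0_norm// /r.
have -> : ep' * (2 * (t * `|v|)) + c * (K * (2 * (ep * (t * `|v|)))) =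
   t * (2 * (ep' * `|v|) + 2 * (ep * (c * K * `|v|))) by ring.
rewrite ler_pM2l// => /le_trans; apply.
have E1 : ep' * `|v| <= e / 4.
  rewrite /ep' mulrAC -ler_pdivlMr// invrK.
  have -> : e / 4 * (4 * (`|v| + 1)) = e * (`|v| + 1) by field.
  by rewrite ler_wpM2l ?(ltW e0)// lerDl.
have E2 : ep * (c * K * `|v|) <= e / 4.
  apply: le_trans epc; rewrite ler_wpM2l ?(ltW ep0)// ler_wpM2l ?lerDl//.
  by rewrite mulr_ge0 ?(ltW c0) ?(ltW K0).
lra.
Qed.

End Lagrange.

(** * Smooth bump functions *)

Section Bump.
Variable R : realType.

(** The family [x^-m exp(-1/x)], extended by 0 to [x <= 0]. Introducing the
    parameter [m] makes it closed under differentiation up to linear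
    combinations, so that smoothness is an induction on the class. *)
Definition flat (m : nat) (x : R) : R :=
  if 0 < x then x^-1 ^+ m * expR (- x^-1) else 0.

(** Directional derivatives are one-variable derivatives, which gives access
    to the one-variable chain rule. *)
Lemma is_derive_line (V : normedModType R) (f : V -> R) (x v : V) (l : R) :
  is_derive x v f l <-> is_derive (0 : R) 1 (fun t : R => f (x + t *: v)) l.
Proof.
have E : (fun h : R => h^-1 *: ((f \o shift x) (h *: v) - f x)) =
   (fun h => h^-1 *: (((fun s : R => f (x + s *: v)) \o shift 0) (h *: 1)
                               - f (x + 0 *: v))).
  apply/funext => h /=; rewrite scale0r !addr0; congr (_ *: (f _ - _)).
  by rewrite [h *: 1]mulr1 addrC.
split=> -[d1 d2]; apply: DeriveDef.
- by move: d1; rewrite /derivable E.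
- by rewrite /derive -E.
- by rewrite /derivable E.
- by rewrite /derive E.
Qed.

Lemma is_derive_comp1 (V : normedModType R) (q : V -> R) (g : R -> R) (x v : V)
    (dq dg : R) :
  is_derive x v q dq -> is_derive (q x) 1 g dg ->
  is_derive x v (fun y => g (q y)) (dg * dq).
Proof.
move=> /is_derive_line Dq Dg; apply/is_derive_line.
apply: (@is_derive1_comp _ g (fun t : R => q (x + t *: v))).
by rewrite scale0r addr0.
Qed.

Lemma flat_ge0 m x : 0 <= flat m x.
Proof.
rewrite /flat; case: ifP => // x0.
by rewrite mulr_ge0 ?expR_ge0// exprn_ge0// invr_ge0 ltW.
Qed.

Lemma flat_gt0 m x : 0 < x -> 0 < flat m x.
Proof.
by move=> x0; rewrite /flat x0 mulr_gt0 ?expR_gt0// exprn_gt0// invr_gt0.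
Qed.

(** From [exp y >= y^(m+1) / (m+1)!] at [y = 1/x]; this gives continuity and
    differentiability at 0. *)
Lemma flat_le m x : flat m x <= (m.+1)`!%:R * `|x|.
Proof.
rewrite /flat; case: ifPn => x0; last by rewrite mulr_ge0.
have y0 : 0 < x^-1 by rewrite invr_gt0.
rewrite gtr0_norm// expRN ler_pdivrMr ?expR_gt0//.
set y := x^-1 in y0 *; have -> : x = y^-1 by rewrite invrK.
have F0 : 0 < (m.+1)`!%:R :> R by rewrite ltr0n fact_gt0.
have H : y ^+ m.+1 / (m.+1)`!%:R <= expR y.
  by have := expR_ge1Dxn m (ltW y0); lra.
have -> : y ^+ m = (m.+1)`!%:R * y^-1 * (y ^+ m.+1 / (m.+1)`!%:R).
  by rewrite exprS; field; rewrite !gt_eqF.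
by rewrite ler_wpM2l// mulr_ge0 ?invr_ge0 ?ltW.
Qed.

(** At the origin the difference quotient of [flat m] is [flat m.+1], which
    tends to 0 by [flat_le]. *)
Lemma is_derive_flat (m : nat) (x : R) :
  is_derive x (1 : R) (flat m) (- (m%:R) * flat m.+1 x + flat m.+2 x).
Proof.
have Eneg z k : z < 0 -> flat k z = 0 by move=> z0; rewrite /flat ltNge ltW.
have [x0|x0|x0] := ltgtP x 0.
- rewrite !Eneg// mulr0 addr0; apply: (@near_eq_is_derive _ _ _ (cst 0)).
    have : \forall y \near x, y < 0 by exact: lt_nbhsl.
    by apply: filterS => y y0; rewrite Eneg.
- have x'0 : x != 0 by rewrite gt_eqF.
  apply: (@near_eq_is_derive R R R (fun y : R => y^-1 ^+ m * expR (- y^-1))).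
    have : \forall y \near x, 0 < y by exact: lt_nbhsr.
    by apply: filterS => y y0; rewrite /flat y0.
  have D1 : is_derive x 1 (fun y : R => y^-1) (- x ^- 2).
    have := @is_deriveV R (fun y : R => y) x 1 1 x'0 _; rewrite /GRing.scale/= mulr1.
    by apply; exact: is_derive_id.
  have D2 : is_derive x 1 (fun y : R => y^-1 ^+ m) (m%:R * x^-1 ^+ m.-1 * (- x ^- 2)).
    have := @is_deriveX R R (fun y : R => y^-1) m x 1 _ D1.
    by rewrite exprfctE.
  have D3 : is_derive x 1 (fun y : R => expR (- y^-1)) (expR (- x^-1) * x ^- 2).
    have D4 : is_derive x 1 (fun y : R => - y^-1) (x ^- 2).
      by have := @is_deriveN R R R (fun y : R => y^-1) x 1 _ D1; rewrite opprK.
    exact: (@is_derive1_comp R expR (fun y : R => - y^-1) x _ _ (is_derive_expR _) D4).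
  have := @is_deriveM R R (fun y : R => y^-1 ^+ m) (fun y : R => expR (- y^-1)) x 1 _ _ D2 D3.
  congr (is_derive _ _ _ _); rewrite /flat x0 /GRing.scale/=.
  case: m {D2} => [|m]/=; first by rewrite -exprVn; ring.
  by rewrite -exprVn !exprS; ring.
rewrite x0; have E k : flat k 0 = 0 by rewrite /flat ltxx.
have lim : h^-1 *: ((flat m \o shift 0) (h *: 1) - flat m 0) @[h --> (0:R)^'] --> (0 : R).
  apply/(@cvgrPdist_le R R^o) => e e0.
  have F0 : 0 < (m.+2)`!%:R :> R by rewrite ltr0n fact_gt0.
  have N : \forall h \near (0 : R)^', `|h| < e / (m.+2)`!%:R.
    by apply: dnbhs0_lt; rewrite divr_gt0.
  near=> h.
  rewrite E /= subr0 addr0 /GRing.scale/= mulr1 sub0r normrN.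
  have -> : h^-1 * flat m h = flat m.+1 h.
    by rewrite /flat; case: ifP => _; rewrite ?mulr0// exprS mulrA.
  rewrite ger0_norm ?flat_ge0// (le_trans (flat_le _ _))// mulrC.
  by rewrite -ler_pdivlMr// ltW//; near: h.
rewrite !E mulr0 addr0.
by apply: DeriveDef; [apply/cvg_ex; exists 0 | exact: cvg_lim lim].
Unshelve. all: by end_near. Qed.

Lemma Ck_flat_comp n k (U : set 'rV[R]_n) (q : 'rV[R]_n -> R) m : open U ->
  (forall k, Ck k U q) -> Ck k U (fun x => flat m (q x)).
Proof.
move=> oU cq; elim: k m => [|k IH] m.
  split=> // x Ux; apply: (@continuous_comp _ _ _ q).
    exact: Ck_continuous (cq 0%N) Ux.
  apply: differentiable_continuous; apply/derivable1_diffP.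
  by have [] := is_derive_flat m (q x).
apply: (@CkS_intro _ _ _ _ _ (fun i x => 'D_(delta_mx 0 i) q x *
   (- (m%:R) * flat m.+1 (q x) + flat m.+2 (q x)))) => //.
- move=> i x Ux; have [Dq1 Dq2] := Ck_derive i (cq 1%N) Ux.
  have [Df1 Df2] := is_derive_flat m (q x).
  have q1 : is_derive x (delta_mx 0 i) q ('D_(delta_mx 0 i) q x) by [].
  by rewrite mulrC; exact: (is_derive_comp1 q1 (is_derive_flat m (q x))).
- move=> i; apply: CkM => //; first by have [_ /(_ i)[]] := cq k.+1.
  apply: CkD => //; apply: CkM => //; exact: Ck_cst.
Qed.

Lemma bump_function n (x : 'rV[R]_n) (r : R) : 0 < r ->
  exists b : 'rV[R]_n -> R,
    [/\ forall y, smooth_at b y, b x = 1 & forall y, b y != 0 -> `|y - x| < r].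
Proof.
move=> r0; pose q (y : 'rV[R]_n) : R :=
  r ^+ 2 + \sum_(i < n) (-1) * ((y 0 i + - x 0 i) * (y 0 i + - x 0 i)).
have f0 : 0 < flat 0 (r ^+ 2) by rewrite flat_gt0// exprn_gt0.
exists (fun y => (flat 0 (r ^+ 2))^-1 * flat 0 (q y)); split.
- move=> y; exists setT; split=> //; first exact: openT.
  have oT : open [set: 'rV[R]_n] by exact: openT.
  move=> k; apply: CkM => //; first exact: Ck_cst.
  apply: Ck_flat_comp => // {}k; apply: CkD => //; first exact: Ck_cst.
  apply: Ck_sum => // i; apply: CkM => //; first exact: Ck_cst.
  by apply: CkM => //; apply: CkD => //; by [exact: Ck_coord|exact: Ck_cst].
- rewrite /q big1 ?addr0 ?mulVf ?gt_eqF// => i _.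
  by rewrite subrr mul0r mulr0.
- move=> y; rewrite mulf_eq0 negb_or => /andP[_].
  rewrite {1}/flat; case: ifPn => [q0 _|_]; last by rewrite eqxx.
  apply: norm_lt_coord => // i; rewrite !mxE.
  have : (y 0 i - x 0 i) ^+ 2 < r ^+ 2.
    move: q0; rewrite /q -mulr_sumr mulN1r subr_gt0; apply: le_lt_trans.
    rewrite (bigD1 i)//= -expr2 lerDl sumr_ge0// => j _.
    by rewrite -expr2 sqr_ge0.
  by rewrite ltr_norml => H; apply/andP; split; nra.
Qed.

End Bump.

(** * Smooth functions and tangent vectors on a manifold *)

Section ManifoldCalculus.
Variable R : realType.
Implicit Types M N : manifold R.

(** The pointwise condition in [smooth_map]. The local extensions of partially
    defined maps used below are smooth at one point only. *)
Definition smooth_map_at M N (F : M -> N) (p : M) : Prop :=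
  {for p, continuous F} /\
  forall i, smooth_fun_at (fun q => coord (F p) (F q) 0 i) p.

Lemma near_cdom M (p q : M) : cdom (chart_at p) q ->
  \forall r \near q, cdom (chart_at p) r.
Proof. by move=> pq; apply: open_nbhs_nbhs; split=> //; exact: cdom_open. Qed.

Lemma near_coord_inv M (p q : M) (P : M -> Prop) : cdom (chart_at p) q ->
  (\forall r \near q, P r) -> \forall y \near coord p q, P (coord_inv p y).
Proof.
move=> pq nP.
have cc : {for coord p q, continuous (coord_inv p)}.
  by apply: cinv_continuous; exists q.
by apply: cc; rewrite /coord_inv /coord cfunK.
Qed.

Lemma near_coord M (p q : M) (P : 'rV[R]_(mdim M) -> Prop) :
  cdom (chart_at p) q ->
  (\forall y \near coord p q, P y) -> \forall r \near q, P (coord p r).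
Proof. by move=> pq nP; exact: (cfun_continuous pq nP). Qed.

(** Charts are homeomorphisms onto open sets, so statements near [q] and near
    its coordinates can be exchanged. Only points of the chart domain may be
    used, the functions being total with irrelevant values elsewhere. *)
Lemma near_coordK M (p q : M) : cdom (chart_at p) q ->
  \forall y \near coord p q,
    cdom (chart_at p) (coord_inv p y) /\ coord p (coord_inv p y) = y.
Proof.
move=> pq.
have : \forall y \near coord p q, (cfun (chart_at p) @` cdom (chart_at p)) y.
  by apply: open_nbhs_nbhs; split; [exact: cimg_open|exists q].
apply: filterS => _ [r pr <-].
by rewrite /coord_inv /coord cfunK.
Qed.

(** The two local expressions differ by the transition map [b -> a], which is
    smooth by compatibility of the atlas. *)
Lemma smooth_at_change_chart M (a b q : M) (f : M -> R) :
  cdom (chart_at a) q -> cdom (chart_at b) q ->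
  smooth_at (f \o coord_inv a) (coord a q) ->
  smooth_at (f \o coord_inv b) (coord b q).
Proof.
move=> aq bq sf.
have E : coord a (coord_inv b (coord b q)) = coord a q.
  by rewrite /coord_inv /coord cfunK.
have nab : \forall y \near coord b q, cdom (chart_at a) (coord_inv b y).
  by apply: near_coord_inv => //; exact: near_cdom.
have nb := near_coordK bq.
have : smooth_at ((f \o coord_inv a) \o (coord a \o coord_inv b)) (coord b q).
  apply: smooth_at_comp => [|j]; first by rewrite /= E.
  apply: smooth_at_nbhs (fun k => chart_compat b a j k).
  apply: filterS2 nab nb => y ya [yb yE].
  by exists (coord_inv b y).
apply: smooth_at_congr; apply: filterS nab => y ya.
by rewrite /= /coord_inv /coord cfunK.
Qed.

(** [smooth_fun_at] refers to the preferred chart at [q]; any chart around [q]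
    will do. This is what allows [q] to vary with the chart fixed. *)
Lemma smooth_fun_atP M (p q : M) (f : M -> R) : cdom (chart_at p) q ->
  smooth_fun_at f q <-> smooth_at (f \o coord_inv p) (coord p q).
Proof.
move=> pq; split; first exact: smooth_at_change_chart (mem_chart_at q) pq.
exact: smooth_at_change_chart pq (mem_chart_at q).
Qed.

Lemma smooth_fun_at_near M (p : M) (f : M -> R) : smooth_fun_at f p ->
  \forall q \near p, smooth_fun_at f q.
Proof.
move=> /smooth_at_near sf; have pp := mem_chart_at p.
have N := near_coord pp sf.
by apply: filterS2 (near_cdom pp) N => q pq /(smooth_fun_atP _ pq).
Qed.

Lemma smooth_fun_at_congr M (p : M) (f g : M -> R) :
  (\forall q \near p, f q = g q) -> smooth_fun_at f p -> smooth_fun_at g p.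
Proof.
move=> fg; apply: smooth_at_congr.
exact: (near_coord_inv (mem_chart_at p) fg).
Qed.

Lemma smooth_fun_at_coord M (p q : M) i : cdom (chart_at p) q ->
  smooth_fun_at (fun r => coord p r 0 i) q.
Proof.
move=> pq; apply/(smooth_fun_atP _ pq); apply: smooth_at_congr (smooth_at_coord i _).
by apply: filterS (near_coordK pq) => y [_ /= ->].
Qed.

Lemma coordK M (p : M) : coord_inv p (coord p p) = p.
Proof. exact/cfunK/mem_chart_at. Qed.

Lemma smooth_fun_at_comp M m (u : M -> 'rV[R]_m) (h : 'rV[R]_m -> R) (p : M) :
  (forall j, smooth_fun_at (fun q => u q 0 j) p) -> smooth_at h (u p) ->
  smooth_fun_at (fun q => h (u q)) p.
Proof.
move=> su sh; apply: (@smooth_at_comp _ _ _ h (u \o coord_inv p)).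
  by rewrite /= coordK.
exact: su.
Qed.

Lemma smooth_fun_at_cst M (p : M) (c : R) : smooth_fun_at (fun=> c) p.
Proof. exact: (smooth_at_cst c). Qed.

Lemma smooth_fun_atD M (p : M) (f g : M -> R) : smooth_fun_at f p ->
  smooth_fun_at g p -> smooth_fun_at (fun q => f q + g q) p.
Proof. exact: smooth_atD. Qed.

Lemma smooth_fun_atM M (p : M) (f g : M -> R) : smooth_fun_at f p ->
  smooth_fun_at g p -> smooth_fun_at (fun q => f q * g q) p.
Proof. exact: smooth_atM. Qed.

Lemma smooth_fun_atN M (p : M) (f : M -> R) : smooth_fun_at f p ->
  smooth_fun_at (fun q => - f q) p.
Proof.
move=> sf; apply: smooth_fun_at_congr (smooth_fun_atM (smooth_fun_at_cst p (-1)) sf).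
by apply: filterE => q; rewrite mulN1r.
Qed.

Lemma smooth_fun_at_sum M (p : M) m (f : 'I_m -> M -> R) :
  (forall i, smooth_fun_at (f i) p) ->
  smooth_fun_at (fun q => \sum_(i < m) f i q) p.
Proof. exact: (@smooth_at_sum _ _ m (fun i => f i \o coord_inv p)). Qed.

(** Near [p], [f o F] is the local expression of [f] composed with the
    coordinates of [F]. *)
Lemma smooth_fun_at_map M N (F : M -> N) (p : M) (f : N -> R) :
  smooth_map_at F p -> smooth_fun_at f (F p) -> smooth_fun_at (fun q => f (F q)) p.
Proof.
move=> [cF sF] sf.
apply: smooth_fun_at_congr (@smooth_fun_at_comp _ _ (fun q => coord (F p) (F q))
  (f \o coord_inv (F p)) p sF sf).
have : \forall q \near p, cdom (chart_at (F p)) (F q).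
  by apply: cF; exact: near_cdom (mem_chart_at _).
by apply: filterS => q pq; rewrite /= /coord_inv /coord cfunK.
Qed.

Lemma smooth_fun_at_derive M (p : M) (v : tangent M) (f : M -> R) :
  smooth_fun_at f p ->
  is_derive (coord p p) (v : 'rV[R]_(mdim M)) (f \o coord_inv p) (act p v f).
Proof.
move=> sf; apply: derivableP.
by have [] := C1_derive (v : 'rV_(mdim M)) (smooth_at_C1 sf).
Qed.

Lemma actE M (p : M) (v : tangent M) (f : M -> R) : smooth_fun_at f p ->
  act p v f = \sum_(i < mdim M) (v : 'rV[R]_(mdim M)) 0 i *
     'D_(delta_mx 0 i) (f \o coord_inv p) (coord p p).
Proof. by move=> /smooth_at_C1/(@C1_derive _ _ _ _ (v : 'rV_(mdim M)))[_ <-]. Qed.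

Lemma act_congr M (p : M) (v : tangent M) (f g : M -> R) :
  (\forall q \near p, f q = g q) -> act p v f = act p v g.
Proof.
move=> fg; apply: near_eq_derive; exact: (near_coord_inv (mem_chart_at p) fg).
Qed.

Lemma act_cst M (p : M) (v : tangent M) (c : R) : act p v (fun=> c) = 0.
Proof. exact: (derive_cst c). Qed.

Lemma actD M (p : M) (v : tangent M) (f g : M -> R) : smooth_fun_at f p ->
  smooth_fun_at g p -> act p v (fun q => f q + g q) = act p v f + act p v g.
Proof.
move=> /(smooth_fun_at_derive v) Df /(smooth_fun_at_derive v) Dg.
by have [_] := is_deriveD Df Dg.
Qed.

Lemma actM M (p : M) (v : tangent M) (f g : M -> R) : smooth_fun_at f p ->
  smooth_fun_at g p ->
  act p v (fun q => f q * g q) = f p * act p v g + g p * act p v f.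
Proof.
move=> /(smooth_fun_at_derive v) Df /(smooth_fun_at_derive v) Dg.
by have [_] := is_deriveM Df Dg; rewrite /= coordK.
Qed.

Lemma actN M (p : M) (v : tangent M) (f : M -> R) : smooth_fun_at f p ->
  act p v (fun q => - f q) = - act p v f.
Proof. by move=> /(smooth_fun_at_derive v) Df; have [_] := is_deriveN Df. Qed.

Lemma act_sum M (p : M) (v : tangent M) m (f : 'I_m -> M -> R) :
  (forall i, smooth_fun_at (f i) p) ->
  act p v (fun q => \sum_(i < m) f i q) = \sum_(i < m) act p v (f i).
Proof.
elim: m f => [|m IH] f sf.
  rewrite big_ord0 -[RHS](act_cst p v 0); apply: act_congr.
  by apply: filterE => q; rewrite big_ord0.
rewrite big_ord_recr/= -IH//= -actD//; last exact: smooth_fun_at_sum.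
by apply: act_congr; apply: filterE => q; rewrite big_ord_recr.
Qed.

Lemma act_lincomb M (p : M) (a : R) (v w : 'rV[R]_(mdim M)) (f : M -> R) :
  smooth_fun_at f p ->
  act p (a *: v + w : 'rV_(mdim M)) f = a * act p v f + act p w f.
Proof.
move=> sf; rewrite !actE// mulr_sumr -big_split/=; apply: eq_bigr => i _.
by rewrite !mxE mulrDl mulrA.
Qed.

Lemma act_addv M (p : M) (v w : 'rV[R]_(mdim M)) (f : M -> R) :
  smooth_fun_at f p ->
  act p (v + w : 'rV_(mdim M)) f = act p v f + act p w f.
Proof. by move=> sf; rewrite -[v]scale1r act_lincomb// scale1r mul1r. Qed.

Lemma act_oppv M (p : M) (v : 'rV[R]_(mdim M)) (f : M -> R) :
  smooth_fun_at f p -> act p (- v : 'rV_(mdim M)) f = - act p v f.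
Proof.
move=> sf; have /eqP := act_addv v (- v) sf.
by rewrite subrr [X in X == _]derive0 eq_sym addrC addr_eq0 => /eqP.
Qed.

(** The chain rule for a function of finitely many smooth functions; taking
    coordinates for [u] it gives both the change of charts and the chain rule
    for maps of manifolds. *)
Lemma act_comp M m (u : M -> 'rV[R]_m) (h : 'rV[R]_m -> R) (p : M)
    (v : tangent M) :
  (forall j, smooth_fun_at (fun q => u q 0 j) p) -> smooth_at h (u p) ->
  act p v (fun q => h (u q)) =
  \sum_(j < m) act p v (fun q => u q 0 j) * 'D_(delta_mx 0 j) h (u p).
Proof.
move=> su /smooth_at_C1 sh.
have [du Eu] : derivable (u \o coord_inv p) (coord p p) (v : 'rV_(mdim M)) /\
    forall j, ('D_(v : 'rV_(mdim M)) (u \o coord_inv p) (coord p p)) 0 j =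
              act p v (fun q => u q 0 j).
  apply: derivable_row => j.
  by have [] := smooth_fun_at_derive v (su j).
rewrite -[u p](_ : (u \o coord_inv p) (coord p p) = _) in sh *; last first.
  by rewrite /= coordK.
have [_] := chain_rule sh du.
by under eq_bigr do rewrite Eu.
Qed.

(** A vector at [q] computed in a chart around [q] that is not the preferred
    one: its components are then its values on the coordinates. *)
Lemma act_chart M (p q : M) (v : tangent M) (f : M -> R) :
  cdom (chart_at p) q -> smooth_fun_at f q ->
  act q v f = \sum_(j < mdim M) act q v (fun r => coord p r 0 j) *
     'D_(delta_mx 0 j) (f \o coord_inv p) (coord p q).
Proof.
move=> pq sf; rewrite -act_comp; last first.
- exact/(smooth_fun_atP _ pq).
- by move=> j; exact: smooth_fun_at_coord.
apply: act_congr; apply: filterS (near_cdom pq) => r pr.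
by rewrite /= /coord_inv /coord cfunK.
Qed.

Lemma act_coord M (p : M) (v : tangent M) i :
  act p v (fun q => coord p q 0 i) = (v : 'rV_(mdim M)) 0 i.
Proof.
rewrite /act; transitivity ('D_(v : 'rV_(mdim M)) (fun y : 'rV[R]_(mdim M) => y 0 i) (coord p p)).
  apply: near_eq_derive; apply: filterS (near_coordK (mem_chart_at p)).
  by move=> y [_ /= ->].
by have [_] := is_derive_coord (coord p p) (v : 'rV_(mdim M)) i.
Qed.

(** A tangent vector is determined by its action on germs of functions, since
    it acts on coordinates by its components. Tangent vectors obtained in
    different ways are compared by this lemma, which avoids coordinates. *)
Lemma tangent_ext M (p : M) (v w : tangent M) :
  (forall f, smooth_fun_at f p -> act p v f = act p w f) -> v = w.
Proof.
move=> vw; apply/rowP => i; rewrite -!(act_coord p); apply: vw.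
exact/smooth_fun_at_coord/mem_chart_at.
Qed.

Lemma act_Tmap M N (F : M -> N) (p : M) (v : tangent M) (f : N -> R) :
  smooth_map_at F p -> smooth_fun_at f (F p) ->
  act (F p) (Tmap F p v) f = act p v (fun q => f (F q)).
Proof.
move=> [cF sF] sf; rewrite actE//.
transitivity (act p v (fun q => (f \o coord_inv (F p)) (coord (F p) (F q)))).
  rewrite (@act_comp _ _ (fun q => coord (F p) (F q)))//.
  by apply: eq_bigr => j _; rewrite mxE.
have : \forall q \near p, cdom (chart_at (F p)) (F q).
  by apply: cF; exact: near_cdom (mem_chart_at _).
move=> N1; apply: act_congr; apply: filterS N1 => q pq.
by rewrite /= /coord_inv /coord cfunK.
Qed.

End ManifoldCalculus.

(** * Fibres of submersions, vector fields and Lie brackets *)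

Section Fibres.
Variable R : realType.
Implicit Types M N : manifold R.

(** A vector tangent to a fibre only sees the restriction of a function to the
    fibre: apply [lagrange_multiplier] to [f - g] in charts. *)
Lemma act_fibre M N (s : M -> N) (p : M) (v : tangent M) (f g : M -> R) :
  submersion s -> Tmap s p v = 0 :> 'rV[R]_(mdim N) ->
  smooth_fun_at f p -> smooth_fun_at g p ->
  (\forall q \near p, s q = s p -> f q = g q) -> act p v f = act p v g.
Proof.
move=> [/(_ p)[cs ss] sur] sv sf sg fg.
apply/eqP; rewrite -subr_eq0; apply/eqP.
have sh : smooth_fun_at (fun q => f q + - g q) p.
  by apply: smooth_fun_atD => //; exact: smooth_fun_atN.
rewrite -actN// -actD//; last exact: smooth_fun_atN.
pose sc (y : 'rV[R]_(mdim M)) := coord (s p) (s (coord_inv p y)).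
have scp : sc (coord p p) = coord (s p) (s p) by rewrite /sc coordK.
apply: (@lagrange_multiplier _ _ _ sc).
- by move=> j; exact: smooth_at_C1 (ss j).
- move=> w; have [u uw] := sur p w; exists u => j.
  by rewrite -uw mxE.
- move=> j; have := congr1 (fun u : 'rV[R]_(mdim N) => u 0 j) sv.
  by rewrite !mxE.
- exact: smooth_at_C1 sh.
- have N1 : \forall q \near p, cdom (chart_at (s p)) (s q).
    by apply: cs; exact: near_cdom (mem_chart_at _).
  have N2 : \forall q \near p, coord (s p) (s q) = coord (s p) (s p) ->
      f q + - g q = f p + - g p.
    have fgp : f p = g p by apply: (nbhs_singleton fg).
    apply: filterS2 N1 fg => q sq fgq E.
    have sqp : s q = s p.
      rewrite -[LHS](cfunK sq) -[RHS](cfunK (mem_chart_at (s p))).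
      by congr (cinv _ _).
    by rewrite fgq// fgp !subrr.
  apply: filterS (near_coord_inv (mem_chart_at p) N2) => y.
  by rewrite scp /= coordK.
Qed.

(** Independence of the extension: [act_on], which chooses some smooth local
    extension, can be computed with any of them. *)
Lemma act_on_ext M N (s : M -> N) (p : M) (v : tangent M) (f F : M -> R) :
  submersion s -> Tmap s p v = 0 :> 'rV[R]_(mdim N) -> smooth_fun_at F p ->
  (\forall q \near p, s q = s p -> F q = f q) ->
  act_on [set q | s q = s p] p v f = act p v F.
Proof.
move=> hs sv sF Ff; rewrite /act_on.
set P := [set F : M -> R | _].
have [sG Gf] : P (xget (cst 0) P) by apply: xgetPex; exists F.
apply: act_fibre hs sv sG sF _.
by apply: filterS2 Gf Ff => q Gq Fq sq; rewrite Gq// Fq.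
Qed.

(** A local form of [smooth_vector_field]: it is tested on germs, hence also
    on coordinates and on local extensions, without cutting them off. *)
Definition smooth_derivation M (V : vector_field M) : Prop :=
  forall (f : M -> R) q, smooth_fun_at f q ->
    smooth_fun_at (fun r => act r (V r) f) q.

(** The algebra behind [act_lie_bracket]: [H] is the symmetric matrix of second
    derivatives of a function, [v] and [w] are the components of two vectors, [a]
    and [b] the derivatives of the components of one field along the other. *)
Lemma second_order_terms_cancel n (a b v w d : 'I_n -> R) (H : 'I_n -> 'I_n -> R) :
  (forall i j, H i j = H j i) ->
  \sum_(j < n) (a j - b j) * d j =
  \sum_(j < n) (a j * d j + w j * \sum_(i < n) v i * H i j) -
  \sum_(j < n) (b j * d j + v j * \sum_(i < n) w i * H i j).
Proof.
move=> HC; rewrite !big_split/= opprD addrACA -sumrB.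
under [X in _ = _ + (X - _)]eq_bigr do rewrite mulr_sumr.
under [X in _ = _ + (_ - X)]eq_bigr do rewrite mulr_sumr.
rewrite [X in _ = _ + (_ - X)]exchange_big/= -[X in _ = _ + X]sumrB.
rewrite [X in _ = _ + X]big1 ?addr0 => [|j _].
  by apply: eq_bigr => j _; rewrite mulrBl.
by rewrite -sumrB big1// => i _; rewrite (HC i j); ring.
Qed.

(** The bracket, defined by its components, acts as the commutator: expand both
    iterated derivatives in a chart; the first order terms give the components
    and the second order ones cancel by symmetry of second derivatives. *)
Lemma act_lie_bracket M (V W : vector_field M) (f : M -> R) (p : M) :
  smooth_derivation V -> smooth_derivation W -> smooth_fun_at f p ->
  act p (lie_bracket V W p) f =
  act p (V p) (fun q => act q (W q) f) - act p (W p) (fun q => act q (V q) f).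
Proof.
move=> sV sW sf; pose ft := f \o coord_inv p.
pose x : M -> 'rV[R]_(mdim M) := coord p.
pose d (j : 'I_(mdim M)) y := 'D_(delta_mx 0 j) ft y.
have sx j : smooth_fun_at (fun q => x q 0 j) p.
  exact/smooth_fun_at_coord/mem_chart_at.
have sd j : smooth_at (d j) (x p) by exact: smooth_at_partial.
have sdx j : smooth_fun_at (fun q => d j (x q)) p.
  by apply: smooth_fun_at_comp.
(* The local expansion of A (B f) at p. *)
have key (A B : vector_field M) : smooth_derivation A -> smooth_derivation B ->
  act p (A p) (fun q => act q (B q) f) =
  \sum_(j < mdim M) (act p (A p) (fun q => act q (B q) (fun r => x r 0 j)) * d j (x p)
   + (B p : 'rV_(mdim M)) 0 j *
     \sum_(i < mdim M) (A p : 'rV_(mdim M)) 0 i * 'D_(delta_mx 0 i) (d j) (x p)).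
  move=> sA sB.
  have sBx j : smooth_fun_at (fun q => act q (B q) (fun r => x r 0 j)) p.
    exact: sB.
  transitivity (act p (A p) (fun q => \sum_(j < mdim M)
      act q (B q) (fun r => x r 0 j) * d j (x q))).
    apply: act_congr.
    apply: filterS2 (near_cdom (mem_chart_at p)) (smooth_fun_at_near sf).
    by move=> q pq sq; rewrite (act_chart _ pq).
  rewrite act_sum => [|j]; last exact: smooth_fun_atM.
  apply: eq_bigr => j _; rewrite actM// addrC [X in X + _]mulrC act_coord.
  congr (_ + _ * _).
  rewrite (@act_comp _ _ _ x (d j))//.
  by apply: eq_bigr => i _; rewrite act_coord.
rewrite (key V W sV sW) (key W V sW sV) actE//.
transitivity (\sum_(j < mdim M) (act p (V p) (fun q => act q (W q) (fun r => x r 0 j))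
   - act p (W p) (fun q => act q (V q) (fun r => x r 0 j))) * d j (x p)).
  by apply: eq_bigr => j _; rewrite mxE.
exact: (second_order_terms_cancel
  (fun j => act p (V p) (fun q => act q (W q) (fun r => x r 0 j)))
  (fun j => act p (W p) (fun q => act q (V q) (fun r => x r 0 j)))
  (fun j => (V p : 'rV_(mdim M)) 0 j) (fun j => (W p : 'rV_(mdim M)) 0 j)
  (fun j => d j (x p)) (fun i j => partialC i j sf)).
Qed.

(** Take the vector field that is constant in the chart at [p], multiply it by a
    bump function and extend it by 0. The support of the bump function is
    compact, hence closed as the manifold is Hausdorff, and this makes the
    extension by 0 smooth. *)
Lemma smooth_field_through M (p : M) (v : tangent M) :
  exists2 V : vector_field M, smooth_derivation V & V p = v.
Proof.
pose c := chart_at p.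
have nI : nbhs (coord p p) (cfun c @` cdom c).
  by apply: open_nbhs_nbhs; split; [exact: cimg_open|exists p => //; exact: mem_chart_at].
have [e /= e0 eI] := (nbhs_ballP _ _).1 nI.
have e20 : 0 < e / 2 by rewrite divr_gt0.
have [b [sb bp bsupp]] := bump_function (coord p p) e20.
pose K := [set y : 'rV[R]_(mdim M) | `|y - coord p p| <= e / 2].
have KI : K `<=` cfun c @` cdom c.
  move=> y /= yK; apply: eI; rewrite -ball_normE/= distrC (le_lt_trans yK)//.
  by rewrite ltr_pdivrMr// ltr_pMr// ltr1n.
have cK : compact K.
  apply: bounded_closed_compact.
    exists (`|coord p p| + e / 2); split; first exact: num_real.
    move=> t lt y /= yK; rewrite (le_trans _ (ltW lt))//.
    rewrite -[y](subrK (coord p p)) addrC (le_trans (ler_normD _ _))//.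
    by rewrite lerD2l.
  apply: (@preimage_closed _ _ (fun y : 'rV[R]_(mdim M) => `|y - coord p p|)
    [set t | t <= e / 2]); last exact: closed_le.
  move=> y _; apply: continuous_comp; last exact: norm_continuous.
  by apply: continuousB; [by move=> A|exact: cst_continuous].
pose Q := cinv c @` K.
have clQ : closed Q.
  apply: compact_closed; first exact: manifold_hausdorff.
  apply: continuous_compact => //.
  apply: continuous_in_subspaceT => y; rewrite inE => Ky.
  by apply: cinv_continuous; exact: KI.
pose V : vector_field M := fun q => if pselect (cdom c q) then
  b (coord p q) *: \row_i 'D_(v : 'rV_(mdim M))
     (fun y => coord q (coord_inv p y) 0 i) (coord p q) else 0.
(* On the chart domain, V acts as the bump function times the derivative of
   the local expression in the constant direction v. *)
have VE q f : cdom c q -> smooth_fun_at f q -> act q (V q) f =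
    b (coord p q) * 'D_(v : 'rV_(mdim M)) (f \o coord_inv p) (coord p q).
  move=> pq sf; rewrite /V; case: pselect => [pq'|//] /=.
  have qq := mem_chart_at q.
  rewrite actE//.
  transitivity (b (coord p q) * \sum_(i < mdim M)
     'D_(v : 'rV_(mdim M)) (fun y => coord q (coord_inv p y) 0 i) (coord p q) *
     'D_(delta_mx 0 i) (f \o coord_inv q) (coord q q)).
    by rewrite mulr_sumr; apply: eq_bigr => i _; rewrite !mxE mulrA.
  congr (_ * _).
  have Eq : coord_inv p (coord p q) = q by rewrite /coord_inv /coord cfunK.
  have [du Eu] : derivable (coord q \o coord_inv p) (coord p q) (v : 'rV_(mdim M)) /\
    forall j, ('D_(v : 'rV_(mdim M)) (coord q \o coord_inv p) (coord p q)) 0 j =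
      'D_(v : 'rV_(mdim M)) (fun y => coord q (coord_inv p y) 0 j) (coord p q).
    apply: derivable_row => j.
    have sj : smooth_at (fun y => coord q (coord_inv p y) 0 j) (coord p q).
      apply/(@smooth_fun_atP _ _ _ _ (fun r => coord q r 0 j) pq).
      exact: smooth_fun_at_coord.
    by have [] := C1_derive (v : 'rV_(mdim M)) (smooth_at_C1 sj).
  have sfq : C1_at (f \o coord_inv q) ((coord q \o coord_inv p) (coord p q)).
    by rewrite /= Eq; exact: smooth_at_C1 sf.
  have [_ H] := chain_rule sfq du.
  rewrite /= Eq in H; under eq_bigr do rewrite -Eu.
  rewrite -H; apply: near_eq_derive.
  have := near_coord_inv pq (near_cdom qq).
  by apply: filterS => y qy; rewrite /= /coord_inv /coord cfunK.
exists V.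
  move=> f q sf; have [pq|npq] := pselect (cdom c q).
    apply: (@smooth_fun_at_congr _ _ _ (fun r => (fun y => b y *
       'D_(v : 'rV_(mdim M)) (f \o coord_inv p) y) (coord p r))).
      apply: filterS2 (near_cdom pq) (smooth_fun_at_near sf) => r pr sr.
      by rewrite VE.
    apply: (@smooth_fun_at_comp _ _ _ (coord p) (fun y => b y *
       'D_(v : 'rV_(mdim M)) (f \o coord_inv p) y)) => [j|].
      exact: smooth_fun_at_coord.
    apply: smooth_atM; first exact: sb.
    by apply: smooth_at_derive; exact/(smooth_fun_atP _ pq).
  apply: smooth_fun_at_congr (smooth_fun_at_cst q 0).
  have nQ : \forall r \near q, ~ Q r.
    apply: open_nbhs_nbhs; split; first exact: closed_openC.
    move=> [y Ky yq]; apply: npq; have [r cr ry] := KI y Ky.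
    by rewrite -yq -ry cfunK.
  apply: filterS nQ => r nQr; rewrite /V; case: pselect => [cr|ncr] /=; last first.
    by rewrite /act derive0.
  have [b0|b0] := eqVneq (b (coord p r)) 0; first by rewrite b0 scale0r /act derive0.
  case: nQr; exists (coord p r); last exact: cfunK.
  by rewrite /K/= ltW// bsupp.
apply: (@tangent_ext _ _ p) => f sf.
by rewrite VE//; [rewrite bp mul1r|exact: mem_chart_at].
Qed.

End Fibres.

(** * Smooth maps and derivatives along fibres *)

Section SmoothMaps.
Variable R : realType.
Implicit Types M N P : manifold R.

Lemma smooth_fun_at_continuous M (p : M) (f : M -> R) : smooth_fun_at f p ->
  {for p, continuous f}.
Proof.
move=> sf; have nK : \forall q \near p, (f \o coord_inv p) (coord p q) = f q.
  apply: filterS (near_cdom (mem_chart_at p)) => q pq.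
  by rewrite /= /coord_inv /coord cfunK.
apply/continuousPeps => e e0.
have := (continuousPeps _ _).1 (C1_continuous (smooth_at_C1 sf)) e e0.
move=> /(near_coord (mem_chart_at p)); apply: filterS2 nK => q <-.
by rewrite /= coordK.
Qed.

Lemma smooth_map_at_id M (p : M) : smooth_map_at id p.
Proof.
by split=> [A|i] //; exact/smooth_fun_at_coord/mem_chart_at.
Qed.

Lemma smooth_map_at_cst M N (c : N) (p : M) : smooth_map_at (fun=> c) p.
Proof.
by split=> [|i]; [exact: cst_continuous|exact: smooth_fun_at_cst].
Qed.

Lemma smooth_map_at_comp M N P (F : M -> N) (H : N -> P) (p : M) :
  smooth_map_at F p -> smooth_map_at H (F p) ->
  smooth_map_at (fun q => H (F q)) p.
Proof.
move=> sF [cH sH]; split=> [|i].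
  by apply: (@continuous_comp _ _ _ F H) => //; case: sF.
exact: (smooth_fun_at_map sF (sH i)).
Qed.

Lemma Tmap_eq0P M N (F : M -> N) (p : M) (v : tangent M) :
  Tmap F p v = 0 :> 'rV[R]_(mdim N) <->
  forall i, act p v (fun q => coord (F p) (F q) 0 i) = 0.
Proof.
split=> [/rowP Fv i|Fv]; first by have := Fv i; rewrite !mxE.
by apply/rowP => i; rewrite !mxE.
Qed.

(** The base point [q] is kept apart from [F p] as the two are usually equal
    only up to the groupoid laws. *)
Lemma act_Tmap_at M N (F : M -> N) (p : M) (v : tangent M) (q : N) (f : N -> R) :
  F p = q -> smooth_map_at F p -> smooth_fun_at f q ->
  act q (Tmap F p v) f = act p v (fun r => f (F r)).
Proof. by move=> <-; exact: act_Tmap. Qed.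

Lemma smooth_fun_at_map_at M N (F : M -> N) (p : M) (q : N) (f : N -> R) :
  F p = q -> smooth_map_at F p -> smooth_fun_at f q ->
  smooth_fun_at (fun r => f (F r)) p.
Proof. by move=> <-; exact: smooth_fun_at_map. Qed.

Lemma TmapN M N (F : M -> N) (p : M) (v : tangent M) : smooth_map_at F p ->
  Tmap F p (- (v : 'rV[R]_(mdim M))) = - (Tmap F p v : 'rV[R]_(mdim N)).
Proof. by move=> [_ sF]; apply/rowP => i; rewrite !mxE act_oppv. Qed.

(** [act_on] chooses among the extensions of [f] restricted to [A], and this set
    only depends on the germ of that restriction. *)
Lemma act_on_congr M (A : set M) (p : M) (v : tangent M) (f g : M -> R) :
  (\forall q \near p, A q -> f q = g q) -> act_on A p v f = act_on A p v g.
Proof.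
move=> fg; rewrite /act_on; congr (act _ _ (xget _ _)).
apply/seteqP; split=> F [sF Ff]; split=> //.
  by apply: filterS2 fg Ff => q E1 E2 Aq; rewrite E2// E1.
by apply: filterS2 fg Ff => q E1 E2 Aq; rewrite E2// E1.
Qed.

Lemma Tmap_on_ext M N P (s : M -> P) (p : M) (v : tangent M) (F E : M -> N) :
  submersion s -> Tmap s p v = 0 :> 'rV[R]_(mdim P) ->
  smooth_map_at E p -> (\forall q \near p, s q = s p -> E q = F q) ->
  Tmap_on [set q | s q = s p] F p v = Tmap E p v.
Proof.
move=> hs sv [_ sE] EF; apply/rowP => i; rewrite !mxE.
have EFp : E p = F p by exact: (nbhs_singleton EF).
rewrite -EFp; apply: (@act_on_ext _ _ _ _ _ _ _ (fun q => coord (E p) (E q) 0 i) hs sv).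
  exact: sE.
by apply: filterS EF => q Eq sq; rewrite Eq.
Qed.

End SmoothMaps.

(** * Cancellation laws in a groupoid *)

Section GroupoidAlgebra.
Variables (R : realType) (G : lie_groupoid R).
Implicit Types g h k : G.

Lemma gmulKV g k : src g = src k -> gmul g (gmul (ginv g) k) = k.
Proof.
by move=> gk; rewrite -mul_assoc ?src_inv ?tgt_inv// mul_inv gk unit_mul.
Qed.

Lemma gmulK g k : tgt g = src k -> gmul (ginv g) (gmul g k) = k.
Proof.
by move=> gk; rewrite -mul_assoc ?src_inv ?tgt_inv// inv_mul gk unit_mul.
Qed.

Lemma ginv_unique g k : tgt g = src k -> gmul g k = idsec (src g) -> k = ginv g.
Proof.
move=> gk E; rewrite -[LHS](gmulK gk) E -[X in idsec X]tgt_inv.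
by rewrite mul_unit.
Qed.

Lemma ginvK g : ginv (ginv g) = g.
Proof.
by apply/esym/ginv_unique; [exact: tgt_inv|rewrite inv_mul src_inv].
Qed.

Lemma ginvM g h : tgt g = src h -> ginv (gmul g h) = gmul (ginv h) (ginv g).
Proof.
move=> gh; apply/esym; apply: ginv_unique.
  by rewrite tgt_mul// src_mul ?src_inv// tgt_inv.
rewrite mul_assoc ?src_mul ?tgt_mul ?src_inv ?tgt_inv//.
by rewrite gmulKV ?src_inv// mul_inv.
Qed.

End GroupoidAlgebra.

(** * Smooth extensions of the partial multiplication *)

Section Translations.
Variables (R : realType) (G : lie_groupoid R).
Implicit Types g h k : G.

(** The hypothesis [mul_smooth] solved for the product: near [(g, h)] the
    multiplication is the restriction to composable pairs of a smooth map,
    written in charts. *)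
Lemma mul_chart g h : tgt g = src h ->
  exists E : 'rV[R]_(mdim G + mdim G) -> 'rV[R]_(mdim G),
  [/\ E (row_mx (coord g g) (coord h h)) = coord (gmul g h) (gmul g h),
      forall i, smooth_at (fun x => E x 0 i) (row_mx (coord g g) (coord h h)) &
      \forall z \near (g, h), tgt z.1 = src z.2 ->
        gmul z.1 z.2 =
        coord_inv (gmul g h) (E (row_mx (coord g z.1) (coord h z.2)))].
Proof.
move=> gh; have [W [E [oW Wx cE EP]]] := @mul_smooth R G g h gh.
exists E; split.
- by have /= [_ ->] := nbhs_singleton EP gh.
- by move=> i; exists W; split=> // k; exact: cE.
apply: filterS EP => z zE /zE[zd <-].
by rewrite /coord_inv /coord cfunK.
Qed.

Lemma smooth_at_mul_chart g h (E : 'rV[R]_(mdim G + mdim G) -> 'rV[R]_(mdim G))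
    (f : G -> R) :
  E (row_mx (coord g g) (coord h h)) = coord (gmul g h) (gmul g h) ->
  (forall i, smooth_at (fun x => E x 0 i) (row_mx (coord g g) (coord h h))) ->
  smooth_fun_at f (gmul g h) ->
  smooth_at (fun x => f (coord_inv (gmul g h) (E x)))
    (row_mx (coord g g) (coord h h)).
Proof.
move=> Egh sE sf; apply: (@smooth_at_comp _ _ _ (f \o coord_inv (gmul g h)) E) => //.
by rewrite Egh.
Qed.

Lemma smooth_fun_at_row (M : manifold R) (a b : M -> G) (p : M) (j : 'I_(mdim G + mdim G)) :
  smooth_map_at a p -> smooth_map_at b p ->
  smooth_fun_at (fun q =>
    (row_mx (coord (a p) (a q)) (coord (b p) (b q)) : 'rV[R]__) 0 j) p.
Proof.
move=> [_ sa] [_ sb]; case E : (fintype.split j) => [k|k].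
  by apply: smooth_fun_at_congr (sa k); apply: filterE => q; rewrite mxE E.
by apply: smooth_fun_at_congr (sb k); apply: filterE => q; rewrite mxE E.
Qed.

(** The product of two smooth maps is only defined where they are composable;
    locally it is the restriction of a smooth map into the groupoid. Translations
    are the case where one of the two maps is constant. *)
Lemma mul_extension (M : manifold R) (a b : M -> G) (p : M) :
  smooth_map_at a p -> smooth_map_at b p -> tgt (a p) = src (b p) ->
  exists2 E : M -> G, smooth_map_at E p &
    \forall q \near p, tgt (a q) = src (b q) -> E q = gmul (a q) (b q).
Proof.
move=> sa sb ab; have [E [Eab sE nE]] := mul_chart ab.
pose r q : 'rV[R]_(mdim G + mdim G) := row_mx (coord (a p) (a q)) (coord (b p) (b q)).
pose c := gmul (a p) (b p).
pose H q := coord_inv c (E (r q)).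
have Hp : H p = c by rewrite /H /r Eab coordK.
have sEr i : smooth_fun_at (fun q => E (r q) 0 i) p.
  apply: (@smooth_fun_at_comp _ _ _ r (fun x => E x 0 i)) => // j.
  exact: smooth_fun_at_row.
have cEr : {for p, continuous (fun q => E (r q))}.
  by apply: continuous_row => j; exact: smooth_fun_at_continuous.
exists H.
  split=> [|i].
    apply: (@continuous_comp _ _ _ (fun q => E (r q)) (coord_inv c)) => //.
    rewrite /r Eab; apply: cinv_continuous; exists c => //.
    exact: mem_chart_at.
  rewrite Hp; apply: smooth_fun_at_congr (sEr i).
  have nc : \forall y \near E (r p),
      cdom (chart_at c) (coord_inv c y) /\ coord c (coord_inv c y) = y.
    by rewrite /r Eab; exact: near_coordK (mem_chart_at c).
  have nq : \forall q \near p, cdom (chart_at c) (coord_inv c (E (r q))) /\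
      coord c (coord_inv c (E (r q))) = E (r q) by exact: (cEr _ nc).
  by apply: filterS nq => q [_ Eq]; rewrite /H Eq.
have nab : \forall q \near p, tgt (a q, b q).1 = src (a q, b q).2 ->
    gmul (a q, b q).1 (a q, b q).2 =
    coord_inv c (E (row_mx (coord (a p) (a q, b q).1) (coord (b p) (a q, b q).2))).
  exact: (cvg_pair sa.1 sb.1 nE).
by apply: filterS nab => q /= nq /nq ->.
Qed.

End Translations.

(** * Invariant lifts of vectors of the Lie algebroid *)

Section Lifts.
Variables (R : realType) (G : lie_groupoid R).
Implicit Types g h k : G.

(** The values at [g] of the left- and right-invariant vector fields, as
    functions of a single vector of the Lie algebroid instead of a section. *)
Definition left_lift g (v : tangent G) : tangent G :=
  Tmap_on (alpha_fibre (tgt g)) (fun k => gmul g k) (idsec (tgt g)) v.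

Definition right_lift g (v : tangent G) : tangent G :=
  - (Tmap_on (alpha_fibre (src g)) (fun k => gmul (ginv k) g)
       (idsec (src g)) v : 'rV[R]_(mdim G)).

Lemma left_fieldE Y g : left_field Y g = left_lift g (Y (tgt g)).
Proof. by []. Qed.

Lemma right_fieldE Y g : right_field Y g = right_lift g (Y (src g)).
Proof. by []. Qed.

Lemma left_translation_extension g k : tgt g = src k ->
  exists2 E : G -> G, smooth_map_at E k &
    \forall q \near k, src q = src k -> E q = gmul g q.
Proof.
move=> gk; have [E sE nE] := mul_extension (smooth_map_at_cst g k)
  (smooth_map_at_id k) gk.
by exists E => //; apply: filterS nE => q Eq qk; apply: Eq; rewrite gk qk.
Qed.

Lemma right_translation_extension g k : src k = src g ->
  exists2 E : G -> G, smooth_map_at E k &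
    \forall q \near k, src q = src k -> E q = gmul (ginv q) g.
Proof.
move=> kg; have [|E sE nE] := mul_extension (@inv_smooth R G k)
  (smooth_map_at_cst g k); first by rewrite tgt_inv.
by exists E => //; apply: filterS nE => q Eq qk; apply: Eq; rewrite tgt_inv qk.
Qed.

(** Combined with [act_Tmap_at], this replaces the tangent map of a translation,
    which lives on a fibre, by the tangent map of an everywhere defined map. *)
Lemma left_translation_tangent g k (v : tangent G) : tgt g = src k ->
  Valpha k v -> exists E : G -> G, [/\ smooth_map_at E k, E k = gmul g k,
    Tmap_on (alpha_fibre (tgt g)) (fun q => gmul g q) k v = Tmap E k v &
    \forall q \near k, src q = src k -> E q = gmul g q].
Proof.
move=> gk kv; have [E sE nE] := left_translation_extension gk.
exists E; split=> //; first exact: (nbhs_singleton nE).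
by rewrite gk; exact: Tmap_on_ext (@src_submersion R G) kv sE nE.
Qed.

Lemma act_left_translation g k (v : tangent G) (f : G -> R) : tgt g = src k ->
  Valpha k v -> smooth_fun_at f (gmul g k) ->
  act (gmul g k) (Tmap_on (alpha_fibre (tgt g)) (fun q => gmul g q) k v) f =
  act_on (alpha_fibre (tgt g)) k v (fun q => f (gmul g q)).
Proof.
move=> gk kv sf; have [E [sE Ek -> nE]] := left_translation_tangent gk kv.
rewrite -Ek in sf *; rewrite act_Tmap// gk.
rewrite (@act_on_ext _ _ _ _ _ _ _ (fun q => f (E q)) (@src_submersion R G) kv)//.
  exact: smooth_fun_at_map sE sf.
by apply: filterS nE => q Eq qk; rewrite Eq.
Qed.

(** A left translation maps an alpha-fibre into a single alpha-fibre. *)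
Lemma Valpha_left_translation g k (v : tangent G) : tgt g = src k ->
  Valpha k v ->
  Valpha (gmul g k) (Tmap_on (alpha_fibre (tgt g)) (fun q => gmul g q) k v).
Proof.
move=> gk kv; apply/Tmap_eq0P => i.
have [_ ss] := (@src_submersion R G).1 (gmul g k).
rewrite act_left_translation// gk.
rewrite (@act_on_ext _ _ _ _ _ _ _ (fun=> coord (src (gmul g k)) (src g) 0 i)
  (@src_submersion R G) kv) ?act_cst//; first exact: smooth_fun_at_cst.
apply: filterE => q qk; have gq : tgt g = src q by rewrite gk qk.
by rewrite !src_mul.
Qed.

(** Translate [w] back by the inverse of [g]. *)
Lemma Valpha_surjective g (w : tangent G) : Valpha g w ->
  exists2 v, AG (tgt g) v & left_lift g v = w.
Proof.
move=> gw; have ig : tgt (ginv g) = src g by exact: tgt_inv.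
pose v := Tmap_on (alpha_fibre (tgt (ginv g))) (fun q => gmul (ginv g) q) g w.
have Vv : Valpha (idsec (tgt g)) v.
  by have := Valpha_left_translation ig gw; rewrite inv_mul.
exists v => //; apply: (@tangent_ext _ _ g) => f sf.
have g1 : tgt g = src (idsec (tgt g)) by rewrite src_unit.
have g1g : gmul g (idsec (tgt g)) = g by exact: mul_unit.
have := @act_left_translation g (idsec (tgt g)) v f g1 Vv.
rewrite g1g => /(_ sf); rewrite -/(left_lift g v) => ->.
have [F sF nF] := left_translation_extension g1.
have sf1 : smooth_fun_at f (F (idsec (tgt g))).
  by rewrite (nbhs_singleton nF)// g1g.
rewrite [in alpha_fibre _]g1.
rewrite (@act_on_ext _ _ _ _ _ _ _ (fun q => f (F q)) (@src_submersion R G) Vv)//.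
- have [E [sE Eg vE nE]] := left_translation_tangent ig gw.
  rewrite inv_mul in Eg.
  have sfF := smooth_fun_at_map sF sf1.
  rewrite /v vE (act_Tmap_at w Eg sE sfF).
  apply: (act_fibre (@src_submersion R G) gw) => //.
    exact: (smooth_fun_at_map_at Eg sE sfF).
  have nFE : \forall q \near g, src (E q) = src (idsec (tgt g)) ->
      F (E q) = gmul g (E q).
    have nF' : \forall q \near E g, src q = src (idsec (tgt g)) ->
        F q = gmul g q by rewrite Eg.
    exact: (sE.1 _ nF').
  apply: filterS2 nE nFE => q Eq FEq qg.
  have EqE := Eq qg.
  by rewrite FEq EqE ?gmulKV// src_mul ?src_inv ?src_unit// tgt_inv.
- exact: smooth_fun_at_map sF sf1.
- by apply: filterS nF => q Fq /Fq ->.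
Qed.

Lemma act_left_lift g (v : tangent G) (f : G -> R) : AG (tgt g) v ->
  smooth_fun_at f g ->
  act g (left_lift g v) f =
  act_on (alpha_fibre (tgt g)) (idsec (tgt g)) v (fun k => f (gmul g k)).
Proof.
move=> gv sf; have g1 : tgt g = src (idsec (tgt g)) by rewrite src_unit.
have := @act_left_translation g (idsec (tgt g)) v f g1 gv.
by rewrite mul_unit; apply.
Qed.

Lemma Valpha_left_lift g (v : tangent G) : AG (tgt g) v ->
  Valpha g (left_lift g v).
Proof.
move=> gv; have g1 : tgt g = src (idsec (tgt g)) by rewrite src_unit.
by have := Valpha_left_translation g1 gv; rewrite mul_unit.
Qed.

(** Since [k^-1 g = (g^-1 k)^-1], the right lift at [g] is obtained from the left
    lift at [g^-1] by inversion; this reduces all statements on right lifts to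
    left ones. *)
Lemma right_lift_inv g (v : tangent G) : AG (src g) v ->
  right_lift g v = - (Tmap (@ginv R G) (ginv g) (left_lift (ginv g) v) :
                       'rV[R]_(mdim G)).
Proof.
move=> gv; congr (- _).
have ig : tgt (ginv g) = src (idsec (src g)) by rewrite src_unit tgt_inv.
have [E [sE Ek vE nE]] := left_translation_tangent ig gv.
have Ekg : E (idsec (src g)) = ginv g by rewrite Ek -[X in idsec X]tgt_inv mul_unit.
rewrite /left_lift !tgt_inv in vE *; rewrite vE.
have sI := @inv_smooth R G.
have sEI : smooth_map_at (fun q => ginv (E q)) (idsec (src g)).
  by apply: smooth_map_at_comp => //; exact: sI.
have E1 : ginv (E (idsec (src g))) = g by rewrite Ekg ginvK.
transitivity (Tmap (fun q => ginv (E q)) (idsec (src g)) v).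
  rewrite -[X in alpha_fibre X](src_unit (src g)).
  apply: Tmap_on_ext (@src_submersion R G) gv sEI _.
  apply: filterS nE => q Eq qk; rewrite Eq// ginvM ?ginvK//.
  by rewrite tgt_inv qk src_unit.
apply: (@tangent_ext _ _ g) => f sf.
have sfi := smooth_fun_at_map_at (ginvK g) (sI _) sf.
by rewrite (act_Tmap_at (F := fun q => ginv (E q)) v E1 sEI sf) (act_Tmap_at _ (ginvK g) (sI _) sf)
  (act_Tmap_at v Ekg sE sfi).
Qed.

Lemma Vbeta_surjective g (w : tangent G) : Vbeta g w ->
  exists2 v, AG (src g) v & right_lift g v = w.
Proof.
move=> gw; have sI := @inv_smooth R G.
pose w' := - (Tmap (@ginv R G) g w : 'rV[R]_(mdim G)).
have Vw' : Valpha (ginv g) w'.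
  apply/Tmap_eq0P => i.
  have [_ ss] := (@src_submersion R G).1 (ginv g).
  rewrite act_oppv// (act_Tmap_at w (erefl (ginv g)) (sI g) (ss i)).
  have /Tmap_eq0P/(_ i) E := gw.
  apply/eqP; rewrite oppr_eq0 -[X in _ == X]E; apply/eqP.
  by apply: act_congr; apply: filterE => q; rewrite !src_inv.
have [v] := Valpha_surjective Vw'; rewrite tgt_inv => gv vw.
exists v => //; rewrite right_lift_inv// vw; apply: (@tangent_ext _ _ g) => f sf.
have sfi := smooth_fun_at_map_at (ginvK g) (sI _) sf.
rewrite act_oppv// (act_Tmap_at _ (ginvK g) (sI _) sf).
rewrite act_oppv// opprK (act_Tmap_at w (erefl (ginv g)) (sI g) sfi).
by apply: act_congr; apply: filterE => q; rewrite ginvK.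
Qed.

Lemma act_right_lift_inv g (v : tangent G) (f : G -> R) : AG (src g) v ->
  smooth_fun_at f g ->
  act g (right_lift g v) f =
  - act (ginv g) (left_lift (ginv g) v) (fun q => f (ginv q)).
Proof.
move=> gv sf; rewrite right_lift_inv// act_oppv//; congr (- _).
exact: act_Tmap_at (ginvK g) (@inv_smooth R G _) sf.
Qed.

Lemma act_right_lift g (v : tangent G) (f : G -> R) : AG (src g) v ->
  smooth_fun_at f g ->
  act g (right_lift g v) f =
  - act_on (alpha_fibre (src g)) (idsec (src g)) v (fun k => f (gmul (ginv k) g)).
Proof.
move=> gv sf; rewrite act_right_lift_inv// act_left_lift ?tgt_inv//; last first.
  exact: smooth_fun_at_map_at (ginvK g) (@inv_smooth R G _) sf.
congr (- _); apply: act_on_congr; apply: filterE => k /= kg.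
by rewrite ginvM ?ginvK// tgt_inv kg.
Qed.

Lemma Vbeta_right_lift g (v : tangent G) : AG (src g) v ->
  Vbeta g (right_lift g v).
Proof.
move=> gv; apply/Tmap_eq0P => i.
have [_ st] := (@tgt_submersion R G).1 g.
rewrite act_right_lift_inv//.
have := Valpha_left_lift (g := ginv g) (v := v); rewrite tgt_inv => /(_ gv).
move=> /Tmap_eq0P/(_ i) E.
apply/eqP; rewrite oppr_eq0; apply/eqP; rewrite -[RHS]E.
by apply: act_congr; apply: filterE => q; rewrite src_inv tgt_inv.
Qed.

End Lifts.

(** * Sections of the Lie algebroid and their invariant vector fields *)

Section Sections.
Variables (R : realType) (G : lie_groupoid R).

(** The smoothness condition of [AG_section], tested on germs. *)
Definition smooth_along (Y : base G -> tangent G) : Prop :=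
  forall (f : G -> R) x, smooth_fun_at f (idsec x) ->
    smooth_fun_at (fun x => act (idsec x) (Y x) f) x.

Lemma AG_section_along Y : (forall x, AG x (Y x)) -> smooth_along Y ->
  AG_section Y.
Proof. by move=> AY sY; split=> // f sf x; apply: sY; exact: sf. Qed.

(** The map [r = idsec o src] is a projection of the groupoid onto its units, so
    [v - Tr v] projects tangent vectors at the units onto the kernel of the
    tangent map of [src]. Applied to a smooth vector field that extends [v], this
    gives the section. *)
Lemma AG_section_through (x0 : base G) (v : tangent G) : AG x0 v ->
  exists Y, [/\ forall x, AG x (Y x), smooth_along Y & Y x0 = v].
Proof.
move=> v0; have [V sV Vv] := smooth_field_through (idsec x0) v.
pose r (g : G) : G := idsec (src g).
have sr g : smooth_map_at r g.
  by apply: smooth_map_at_comp; [exact: (@src_submersion R G).1|exact: unit_smooth].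
have r1 x : r (idsec x) = idsec x by rewrite /r src_unit.
pose Y x : tangent G := (V (idsec x) : 'rV[R]_(mdim G)) -
  Tmap r (idsec x) (V (idsec x)).
have YE x f : smooth_fun_at f (idsec x) -> act (idsec x) (Y x) f =
    act (idsec x) (V (idsec x)) (fun g => f g - f (r g)).
  move=> sf; have sfr := smooth_fun_at_map_at (r1 x) (sr _) sf.
  rewrite act_addv// act_oppv// (act_Tmap_at _ (r1 x) (sr _) sf).
  by rewrite actD ?actN//; exact: smooth_fun_atN.
have AY x : AG x (Y x).
  apply/Tmap_eq0P => i.
  have [_ ss] := (@src_submersion R G).1 (idsec x).
  rewrite YE// -[RHS](act_cst (idsec x) (V (idsec x)) 0).
  by apply: act_congr; apply: filterE => g; rewrite /r !src_unit subrr.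
exists Y; split=> //.
  move=> f x sf; have sfr := smooth_fun_at_map_at (r1 x) (sr _) sf.
  have sh : smooth_fun_at (fun g => f g - f (r g)) (idsec x).
    by apply: smooth_fun_atD => //; exact: smooth_fun_atN.
  have sVh := sV _ _ sh.
  apply: smooth_fun_at_congr (smooth_fun_at_map (@unit_smooth R G x) sVh).
  have nf : \forall y \near x, smooth_fun_at f (idsec y).
    exact: ((@unit_smooth R G x).1 _ (smooth_fun_at_near sf)).
  by apply: filterS nf => y sfy; rewrite YE.
apply: (@tangent_ext _ _ (idsec x0)) => f sf.
have sfr := smooth_fun_at_map_at (r1 x0) (sr _) sf.
rewrite YE// Vv actD//; last exact: smooth_fun_atN.
rewrite actN//.
have -> : act (idsec x0) v (fun g => f (r g)) = 0; last by rewrite subr0.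
rewrite -[RHS](act_cst (idsec x0) v (f (idsec x0))).
apply: (act_fibre (@src_submersion R G) v0) => //; first exact: smooth_fun_at_cst.
by apply: filterE => g; rewrite /r src_unit => ->.
Qed.

(** Near [g0], [f (g k) = H (u g k)] for composable pairs, with a smooth function
    [H] of the coordinates [u g k] of the pair. Thus the left-invariant field
    applied to [f] is a sum of partial derivatives of [H] at the unit [e g]
    multiplied by the action of [Y] on the entries of [u]; both depend smoothly
    on [g]. *)
Lemma left_field_smooth Y : (forall x, AG x (Y x)) -> smooth_along Y ->
  smooth_derivation (left_field Y).
Proof.
move=> AY sY f g0 sf; pose p0 : G := idsec (tgt g0).
have gp : tgt g0 = src p0 by rewrite src_unit.
have gp0 : gmul g0 p0 = g0 by exact: mul_unit.
have [E [Egp sE nE]] := mul_chart gp.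
pose H x := f (coord_inv (gmul g0 p0) (E x)).
have sH : smooth_at H (row_mx (coord g0 g0) (coord p0 p0)).
  by apply: smooth_at_mul_chart => //; rewrite gp0.
pose e g : G := idsec (tgt g).
have se g : smooth_map_at e g.
  by apply: smooth_map_at_comp; [exact: (@tgt_submersion R G).1|exact: unit_smooth].
pose u g k : 'rV[R]_(mdim G + mdim G) := row_mx (coord g0 g) (coord p0 k).
have sue j : smooth_fun_at (fun g => u g (e g) 0 j) g0.
  exact: (smooth_fun_at_row (a := id) (b := e) j (smooth_map_at_id g0) (se g0)).
have cue : {for g0, continuous (fun g => u g (e g))}.
  by apply: continuous_row => j; exact: smooth_fun_at_continuous.
have su g k j : cdom (chart_at p0) k -> smooth_fun_at (fun q => u g q 0 j) k.
  move=> pk; case Ej : (fintype.split j) => [i|i].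
    apply: smooth_fun_at_congr (smooth_fun_at_cst k (coord g0 g 0 i)).
    by apply: filterE => q; rewrite mxE Ej.
  apply: smooth_fun_at_congr (smooth_fun_at_coord i pk).
  by apply: filterE => q; rewrite mxE Ej.
have suY j : smooth_fun_at (fun g => act (e g) (Y (tgt g)) (fun q => u g q 0 j)) g0.
  case Ej : (fintype.split j) => [i|i].
    apply: smooth_fun_at_congr (smooth_fun_at_cst g0 0).
    apply: filterE => g; rewrite -[LHS](act_cst (e g) (Y (tgt g)) (coord g0 g 0 i)).
    by apply: act_congr; apply: filterE => q; rewrite mxE Ej.
  have sc := smooth_fun_at_coord i (mem_chart_at p0).
  apply: smooth_fun_at_congr (smooth_fun_at_map ((@tgt_submersion R G).1 g0) (sY _ _ sc)).
  apply: filterE => g.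
  by apply: act_congr; apply: filterE => q; rewrite mxE Ej.
apply: (@smooth_fun_at_congr _ _ _ (fun g => \sum_(j < mdim G + mdim G)
   act (e g) (Y (tgt g)) (fun q => u g q 0 j) * 'D_(delta_mx 0 j) H (u g (e g)))); last first.
  apply: smooth_fun_at_sum => j; apply: smooth_fun_atM; first exact: suY.
  apply: (@smooth_fun_at_comp _ _ _ (fun g => u g (e g))
    (fun x => 'D_(delta_mx 0 j) H x)) => //.
  exact: smooth_at_partial.
have n1 := smooth_fun_at_near sf.
have n2 : \forall g \near g0, smooth_at H (u g (e g)).
  exact: (cue _ (smooth_at_near sH)).
have n3 : \forall g \near g0, cdom (chart_at p0) (e g).
  exact: ((se g0).1 _ (near_cdom (mem_chart_at p0))).
have n4 : \forall g \near g0, \forall z \near (g, e g), tgt z.1 = src z.2 ->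
    f (gmul z.1 z.2) = H (u z.1 z.2).
  have nf : \forall z \near (g0, p0), tgt z.1 = src z.2 ->
    f (gmul z.1 z.2) = H (u z.1 z.2).
    by apply: filterS nE => z zE /zE ->.
  have nnf : \forall z \near (g0, p0), \forall w \near z, tgt w.1 = src w.2 ->
    f (gmul w.1 w.2) = H (u w.1 w.2) by exact: (near_join nf).
  have cg : {for g0, continuous (fun g => (g, e g))}.
    exact: cvg_pair (smooth_map_at_id g0).1 (se g0).1.
  exact: (cg _ nnf).
have n12 : \forall g \near g0, smooth_fun_at f g /\ smooth_at H (u g (e g)).
  exact: filterI n1 n2.
apply: filterS3 n12 n3 n4 => g [sfg sHg] pe nz.
rewrite left_fieldE (act_left_lift (AY _) sfg).
have sHu : smooth_fun_at (fun k => H (u g k)) (e g).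
  by apply: (@smooth_fun_at_comp _ _ _ (u g)) => // j; exact: su.
rewrite -(@act_comp _ _ _ (u g) H)//; last by move=> j; exact: su.
have se1 : src (e g) = tgt g by exact: src_unit.
rewrite -[X in alpha_fibre X]se1; apply/esym.
apply: (act_on_ext (@src_submersion R G) (AY _) sHu).
have n5 : \forall k \near e g, tgt g = src k -> f (gmul g k) = H (u g k).
  have cg : {for e g, continuous (fun k : G => (g, k))}.
    by apply: cvg_pair; [exact: cvg_cst|exact: cvg_id].
  exact: (cg _ nz).
by apply: filterS n5 => k fk ks; rewrite fk// ks se1.
Qed.

Lemma right_field_smooth Y : (forall x, AG x (Y x)) -> smooth_along Y ->
  smooth_derivation (right_field Y).
Proof.
move=> AY sY f g sf; have sI := @inv_smooth R G.
have sfi := smooth_fun_at_map_at (ginvK g) (sI _) sf.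
have sQ := smooth_fun_at_map (sI g) (left_field_smooth AY sY sfi).
apply: smooth_fun_at_congr (smooth_fun_atN sQ).
apply: filterS (smooth_fun_at_near sf) => h sh.
by rewrite right_fieldE (act_right_lift_inv (AY _) sh) left_fieldE tgt_inv.
Qed.

Lemma invariant_section_PG X Y : (forall x, AG x (X x)) -> smooth_along X ->
  (forall x, AG x (Y x)) -> smooth_along Y ->
  PG_section (invariant_section X Y).
Proof.
move=> AX sX AY sY; split.
- by move=> g; split; [exact: Vbeta_right_lift|exact: Valpha_left_lift].
- by move=> f sf g; apply: right_field_smooth => //; exact: sf.
- by move=> f sf g; apply: left_field_smooth => //; exact: sf.
Qed.

End Sections.

(** * Naturality of translations under a morphism *)

Section Morphisms.
Variables (R : realType) (G G' : lie_groupoid R).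
Variable Phi : lie_groupoid_morphism G G'.
Implicit Types g h : G.

(** The image of a unit is idempotent, hence a unit. *)
Lemma mor_idsec_src g : Phi (idsec (src g)) = idsec (src (Phi g)).
Proof.
pose e := idsec (src g).
have c2 : composable e e by rewrite /composable tgt_unit src_unit.
have ee : gmul e e = e by have := mul_unit e; rewrite tgt_unit.
have m1 : composable (Phi e) (Phi g).
  by apply: mor_composable; rewrite /composable tgt_unit.
have m2 := mor_composable Phi c2.
rewrite -m1 -[LHS](gmulK m2) -mor_mul// ee.
exact: inv_mul.
Qed.

Lemma mor_inv g : Phi (ginv g) = ginv (Phi g).
Proof.
have c : composable g (ginv g) by rewrite /composable src_inv.
apply: ginv_unique; first exact: mor_composable.
by rewrite -mor_mul// mul_inv mor_idsec_src.
Qed.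

Lemma mor_idsec_tgt g : Phi (idsec (tgt g)) = idsec (tgt (Phi g)).
Proof. by rewrite -src_inv mor_idsec_src mor_inv src_inv. Qed.

Lemma mor_src g h : src g = src h -> src (Phi g) = src (Phi h).
Proof.
move=> gh; rewrite -[LHS]src_unit -[RHS]src_unit.
by rewrite -!mor_idsec_src gh.
Qed.

(** A morphism maps alpha-fibres into alpha-fibres by [mor_src], so [src o Phi] is
    constant along a fibre. *)
Lemma Valpha_mor g (v : tangent G) : Valpha g v -> Valpha (Phi g) (Tmap Phi g v).
Proof.
move=> gv; apply/Tmap_eq0P => i.
have [_ ss] := (@src_submersion R G').1 (Phi g).
rewrite (act_Tmap_at v (erefl (Phi g)) (mor_smooth Phi g) (ss i)).
pose c := coord (src (Phi g)) (src (Phi g)) 0 i.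
rewrite -[RHS](act_cst g v c).
apply: (act_fibre (@src_submersion R G) gv).
- exact: smooth_fun_at_map (mor_smooth Phi g) (ss i).
- exact: smooth_fun_at_cst.
- by apply: filterE => q /mor_src ->.
Qed.

(** Derivatives along alpha-fibres are natural: if [F] is a smooth extension of
    [u] near [Phi p] then [F o Phi] is one of [u o Phi] near [p]. The point [x]
    is kept apart from [src p] for use at units. *)
Lemma act_on_mor x p (v : tangent G) (u F : G' -> R) : src p = x ->
  Valpha p v -> smooth_fun_at F (Phi p) ->
  (\forall q \near Phi p, src q = src (Phi p) -> F q = u q) ->
  act_on (alpha_fibre x) p v (fun k => u (Phi k)) =
  act_on (alpha_fibre (src (Phi p))) (Phi p) (Tmap Phi p v) u.
Proof.
move=> <- pv sF nF.
rewrite (act_on_ext (@src_submersion R G') (Valpha_mor pv) sF nF).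
rewrite (act_Tmap_at v (erefl (Phi p)) (mor_smooth Phi p) sF).
have sFP := smooth_fun_at_map (mor_smooth Phi p) sF.
apply: (act_on_ext (@src_submersion R G) pv sFP).
have nP : \forall q \near p, src (Phi q) = src (Phi p) -> F (Phi q) = u (Phi q).
  exact: ((mor_smooth Phi p).1 _ nF).
by apply: filterS nP => q Fq qp; apply: Fq; exact: mor_src.
Qed.

Lemma act_mor g (v : tangent G) (f : G' -> R) : smooth_fun_at f (Phi g) ->
  act (Phi g) (Tmap Phi g v) f = act g v (f \o Phi).
Proof. exact: act_Tmap (mor_smooth Phi g). Qed.

(** A morphism commutes with products and inverses, so along the alpha-fibre the
    function that defines the operator for [L' o Phi] is the pull-back of the one
    for [L'], and [act_on_mor] applies. *)
Lemma DEL_mor (L' : G' -> R) g h (v : tangent G) : smooth_fun L' ->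
  composable g h -> AG (tgt g) v ->
  DEL (L' \o Phi) g h v = DEL L' (Phi g) (Phi h) (A_map Phi (tgt g) v).
Proof.
move=> sL gh gv; have gh' := mor_composable Phi gh.
pose p := idsec (tgt g).
have pE : Phi p = idsec (tgt (Phi g)) by exact: mor_idsec_tgt.
pose u (k : G') := L' (gmul (Phi g) k) + L' (gmul (ginv k) (Phi h)).
have c1 : tgt (Phi g) = src (Phi p) by rewrite pE src_unit.
have c2 : src (Phi p) = src (Phi h) by rewrite -c1.
have [E1 sE1 nE1] := left_translation_extension c1.
have [E2 sE2 nE2] := right_translation_extension c2.
rewrite /DEL /A_map -/p.
transitivity (act_on (alpha_fibre (tgt g)) p v (fun k => u (Phi k))).
  apply: act_on_congr; apply: filterE => k kg.
  have k1 : composable g k by rewrite /composable kg.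
  have k2 : composable (ginv k) h by rewrite /composable tgt_inv kg.
  by rewrite /u -mor_inv -!mor_mul.
have sF : smooth_fun_at (fun k => L' (E1 k) + L' (E2 k)) (Phi p).
  by apply: smooth_fun_atD; apply: smooth_fun_at_map => //; exact: sL.
rewrite (@act_on_mor _ _ _ _ (fun k => L' (E1 k) + L' (E2 k)) (src_unit (tgt g)) gv sF).
  by rewrite -c1 pE.
by apply: filterS2 nE1 nE2 => k Ek1 Ek2 kp; rewrite Ek1// Ek2.
Qed.

Lemma left_lift_mor g (v : tangent G) : AG (tgt g) v ->
  left_lift (Phi g) (A_map Phi (tgt g) v) = Tmap Phi g (left_lift g v).
Proof.
move=> gv; apply: (@tangent_ext _ _ (Phi g)) => f sf.
pose p := idsec (tgt g).
have pE : Phi p = idsec (tgt (Phi g)) by exact: mor_idsec_tgt.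
have c1 : tgt (Phi g) = src (Phi p) by rewrite pE src_unit.
have gv' : AG (tgt (Phi g)) (A_map Phi (tgt g) v).
  by rewrite /AG -pE; exact: Valpha_mor.
rewrite act_mor// (act_left_lift gv')//.
have sfP := smooth_fun_at_map (mor_smooth Phi g) sf.
rewrite (act_left_lift gv sfP).
have [E sE nE] := left_translation_extension c1.
have sF : smooth_fun_at (fun k => f (E k)) (Phi p).
  apply: smooth_fun_at_map => //.
  by rewrite (nbhs_singleton nE)// pE mul_unit.
rewrite -[X in act_on _ X (A_map _ _ _) _]pE [X in alpha_fibre X]c1.
rewrite -(@act_on_mor (tgt g) p v (fun k => f (gmul (Phi g) k)) _ (src_unit _) gv sF).
  apply: act_on_congr; apply: filterE => k kg.
  by rewrite /= mor_mul// /composable kg.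
by apply: filterS nE => k Ek /Ek ->.
Qed.

Lemma right_lift_mor g (v : tangent G) : AG (src g) v ->
  right_lift (Phi g) (A_map Phi (src g) v) = Tmap Phi g (right_lift g v).
Proof.
move=> gv; have gvi : AG (tgt (ginv g)) v by rewrite tgt_inv.
have gv' : AG (src (Phi g)) (A_map Phi (src g) v).
  by rewrite /AG -mor_idsec_src; exact: Valpha_mor.
have := left_lift_mor gvi; rewrite tgt_inv mor_inv => E.
rewrite !right_lift_inv// E TmapN; last exact: mor_smooth.
congr (- _); apply: (@tangent_ext _ _ (Phi g)) => f sf.
have iP : ginv (Phi (ginv g)) = Phi g by rewrite mor_inv ginvK.
have sI := @inv_smooth R G; have sI' := @inv_smooth R G'.
have sfi := smooth_fun_at_map_at iP (sI' _) sf.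
have sfP := smooth_fun_at_map (mor_smooth Phi g) sf.
rewrite -mor_inv (act_Tmap_at _ iP (sI' _) sf) act_mor//.
rewrite act_mor// (act_Tmap_at _ (ginvK g) (sI _) sfP).
by apply: act_congr; apply: filterE => k; rewrite /= mor_inv.
Qed.

End Morphisms.

(** * The Poincare-Cartan 2-section as a mixed derivative *)

Section MixedDerivative.
Variables (R : realType) (G : lie_groupoid R).

(** The derivative at the units of [L (k1^-1 g k2)] once in [k1] along [xi] and
    once in [k2] along [eta]. As the two derivatives are taken in different
    variables, this only depends on the two vectors and not on any extension of
    them to sections. *)
Definition mixed (L : G -> R) (g : G) (xi eta : tangent G) : R :=
  act_on (alpha_fibre (src g)) (idsec (src g)) xi (fun k1 =>
    act_on (alpha_fibre (tgt g)) (idsec (tgt g)) eta (fun k2 =>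
      L (gmul (gmul (ginv k1) g) k2))).

Lemma act_left_field_translate (L : G -> R) (g k : G) (Y : base G -> tangent G) :
  smooth_fun L -> (forall x, AG x (Y x)) -> src k = src g ->
  act (gmul (ginv k) g) (left_field Y (gmul (ginv k) g)) L =
  act_on (alpha_fibre (tgt g)) (idsec (tgt g)) (Y (tgt g)) (fun k2 =>
      L (gmul (gmul (ginv k) g) k2)).
Proof.
move=> sL AY kg; have c : tgt (ginv k) = src g by rewrite tgt_inv.
by rewrite left_fieldE (act_left_lift (AY _) (sL _)) tgt_mul.
Qed.

(** Deriving along a right lift moves the point inside its beta-fibre by
    [k^-1 g]; along this fibre the left-invariant field keeps using the same
    vector [Y (tgt g)], by [act_left_field_translate]. *)
Lemma act_right_lift_left_field (L : G -> R) (g : G) (xi : tangent G)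
    (Y : base G -> tangent G) : smooth_fun L -> AG (src g) xi ->
  (forall x, AG x (Y x)) -> smooth_along Y ->
  act g (right_lift g xi) (fun h => act h (left_field Y h) L) =
  - mixed L g xi (Y (tgt g)).
Proof.
move=> sL gxi AY sY.
have sP := left_field_smooth AY sY (sL g).
rewrite (act_right_lift (f := fun h => act h (left_field Y h) L) gxi sP).
rewrite /mixed; apply: congr1; apply: act_on_congr; apply: filterE => k kg.
exact: act_left_field_translate.
Qed.

(** Evaluate the differential on invariant sections through the given vectors,
    for which the bracket of the prolongation is known. Writing [R], [R'] for the
    right-invariant and [X], [X'] for the left-invariant fields, one gets
    [(R + X) X' L - (R' + X') X L - [X, X'] L]; the terms with two left-invariant
    fields cancel against the bracket, and [R X' L - R' X L] consists of mixed
    derivatives. *)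
Lemma Omega_lifts brA br (L : G -> R) Omega (g : G) (xi eta xi' eta' : tangent G) :
  is_AG_bracket brA -> is_PG_bracket brA br -> smooth_fun L ->
  is_Omega br L Omega ->
  AG (src g) xi -> AG (tgt g) eta -> AG (src g) xi' -> AG (tgt g) eta' ->
  Omega g (right_lift g xi, left_lift g eta) (right_lift g xi', left_lift g eta') =
  mixed L g xi eta' - mixed L g xi' eta.
Proof.
move=> hA [_ hP] sL hO Axi Aeta Axi' Aeta'.
have [X [AX sX Xg]] := AG_section_through Axi.
have [Y [AY sY Yg]] := AG_section_through Aeta.
have [X' [AX' sX' Xg']] := AG_section_through Axi'.
have [Y' [AY' sY' Yg']] := AG_section_through Aeta'.
have secX := AG_section_along AX sX; have secY := AG_section_along AY sY.
have secX' := AG_section_along AX' sX'; have secY' := AG_section_along AY' sY'.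
have := hO _ _ (invariant_section_PG AX sX AY sY)
  (invariant_section_PG AX' sX' AY' sY') g.
rewrite /invariant_section !left_fieldE !right_fieldE Xg Yg Xg' Yg' => ->.
have dY := left_field_smooth AY sY; have dY' := left_field_smooth AY' sY'.
have sP := dY _ _ (sL g); have sP' := dY' _ _ (sL g).
rewrite /PG_d (hP X Y X' Y' secX secY secX' secY').
rewrite /Theta_plus /PG_anchor /= (hA Y Y' secY secY').2.
rewrite (act_lie_bracket dY dY' (sL g)).
rewrite (act_addv _ _ sP') (act_addv _ _ sP).
rewrite !right_fieldE Xg Xg'.
rewrite (act_right_lift_left_field sL Axi AY' sY').
rewrite (act_right_lift_left_field sL Axi' AY sY) Yg Yg'.
have arith (a b c d : R) : - (- a + c - (- b + d) - (c - d)) = a - b by ring.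
exact: arith.
Qed.

End MixedDerivative.

(** * Pull-back by a morphism *)

Section Naturality.
Variables (R : realType) (G G' : lie_groupoid R).
Variable Phi : lie_groupoid_morphism G G'.

(** Apply [act_on_mor] twice. The outer application needs the inner derivative
    to be smooth in [k1]: it is the value at [k1^-1 g] of the left-invariant field
    of a section through [eta] applied to [L']. *)
Lemma mixed_mor (L' : G' -> R) (g : G) (xi eta : tangent G) : smooth_fun L' ->
  AG (src g) xi -> AG (tgt g) eta ->
  mixed (L' \o Phi) g xi eta =
  mixed L' (Phi g) (A_map Phi (src g) xi) (A_map Phi (tgt g) eta).
Proof.
move=> sL gxi geta.
pose p := idsec (src g); pose q := idsec (tgt g).
have pE : Phi p = idsec (src (Phi g)) by exact: mor_idsec_src.
have qE : Phi q = idsec (tgt (Phi g)) by exact: mor_idsec_tgt.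
pose eta' := A_map Phi (tgt g) eta.
have Aeta' : AG (tgt (Phi g)) eta' by rewrite /AG -qE; exact: Valpha_mor.
pose u k1 := act_on (alpha_fibre (tgt (Phi g))) (idsec (tgt (Phi g))) eta'
  (fun k2 => L' (gmul (gmul (ginv k1) (Phi g)) k2)).
transitivity (act_on (alpha_fibre (src g)) p xi (fun k1 => u (Phi k1))).
  apply: act_on_congr; apply: filterE => k1 k1g.
  have c1 : composable (ginv k1) g by rewrite /composable tgt_inv.
  pose h := gmul (ginv k1) g.
  have hE : gmul (ginv (Phi k1)) (Phi g) = Phi h by rewrite -mor_inv -mor_mul.
  have th : tgt h = tgt g by exact: tgt_mul.
  have tPh : tgt (Phi h) = src (Phi q).
    by rewrite -hE tgt_mul ?qE ?src_unit// -mor_inv; exact: mor_composable.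
  have [E sE nE] := left_translation_extension tPh.
  have sF : smooth_fun_at (fun k => L' (E k)) (Phi q).
    by apply: smooth_fun_at_map => //; exact: sL.
  rewrite /u hE /eta' /A_map -/q -qE.
  have -> : tgt (Phi g) = src (Phi q) by rewrite qE src_unit.
  rewrite -(@act_on_mor _ _ _ Phi (tgt g) q eta (fun k2 => L' (gmul (Phi h) k2))
    _ (src_unit _) geta sF).
    apply: act_on_congr; apply: filterE => k2 k2g.
    by rewrite /= -/h mor_mul// /composable th k2g.
  by apply: filterS nE => k Ek /Ek ->.
have [Y [AY sY Yg]] := AG_section_through Aeta'.
pose P h := act h (left_field Y h) L'.
have sP h : smooth_fun_at P h by exact: left_field_smooth AY sY _ _ (sL h).
have pg : src (Phi p) = src (Phi g) by rewrite pE src_unit.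
have [E sE nE] := right_translation_extension pg.
have sF : smooth_fun_at (fun k => P (E k)) (Phi p).
  by apply: smooth_fun_at_map => //; exact: sP.
rewrite (@act_on_mor _ _ _ Phi (src g) p xi u _ (src_unit _) gxi sF).
  by rewrite pg pE.
apply: filterS nE => k Ek kp; rewrite Ek//.
rewrite /P act_left_field_translate//; last by rewrite kp pg.
by rewrite Yg.
Qed.

End Naturality.

Theorem theorem4p6 (R : realType) (G G' : lie_groupoid R)
    (Phi : lie_groupoid_morphism G G') (L : G -> R) (L' : G' -> R)
    (hL : smooth_fun L) (hL' : smooth_fun L') (hLL' : L = L' \o Phi) :
  [/\ (forall g h : G, composable g h ->
         forall v : tangent G, AG (tgt g) v ->
         DEL L g h v = DEL L' (Phi g) (Phi h) (A_map Phi (tgt g) v)),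
      (forall (g : G) (z : PGspace G), PG g z ->
         pullback1 Phi (Theta_plus L') g z = Theta_plus L g z),
      (forall (g : G) (z : PGspace G), PG g z ->
         pullback1 Phi (Theta_minus L') g z = Theta_minus L g z)
    & (forall brA br brA' br',
         is_AG_bracket brA -> is_PG_bracket brA br ->
         is_AG_bracket brA' -> is_PG_bracket brA' br' ->
         forall (Omega : G -> PGspace G -> PGspace G -> R)
                (Omega' : G' -> PGspace G' -> PGspace G' -> R),
         is_Omega br L Omega -> is_Omega br' L' Omega' ->
         forall (g : G) (z w : PGspace G), PG g z -> PG g w ->
         pullback2 Phi Omega' g z w = Omega g z w)].
Proof.
split.
- by move=> g h gh v gv; rewrite hLL'; exact: DEL_mor.
- by move=> g z _; rewrite hLL'; exact: act_mor (hL' _).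
- by move=> g z _; rewrite hLL'; congr (- _); exact: act_mor (hL' _).
move=> brA br brA' br' hA hP hA' hP' Omega Omega' hO hO' g [z1 z2] [w1 w2].
move=> [/= /Vbeta_surjective[xi Axi <-] /Valpha_surjective[eta Aeta <-]].
move=> [/= /Vbeta_surjective[xi' Axi' <-] /Valpha_surjective[eta' Aeta' <-]].
rewrite /pullback2 /P_map /= -!right_lift_mor// -!left_lift_mor//.
rewrite (Omega_lifts hA hP hL hO)// (Omega_lifts hA' hP' hL' hO').
- by rewrite hLL' !mixed_mor.
- by rewrite /AG -mor_idsec_src; exact: Valpha_mor.
- by rewrite /AG -mor_idsec_tgt; exact: Valpha_mor.
- by rewrite /AG -mor_idsec_src; exact: Valpha_mor.
- by rewrite /AG -mor_idsec_tgt; exact: Valpha_mor.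
Qed.
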